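(* Let $(V,\mu,R)$ be a braided algebra over a unital commutative ring $\mathbb{k}$ and let $(\mu+\hbar\psi_1,R+\hbar\phi_1)$ be an infinitesimal deformation of it. Then the obstruction to extending this infinitesimal deformation to a quadratic deformation lies in the third Yang-Baxter Hochschild cohomology group $H^3_{\rm YBH}(V,V)$; that is, the element $$\Theta_2\oplus(\Xi^{\rm YI}_2-\Omega^{\rm YI}_2)\oplus(\Xi^{\rm IY}_2-\Omega^{\rm IY}_2)\oplus\Lambda_2\ \in\ C^3_{\rm YBH}(V,V)$$ satisfies $$\delta^3_{\rm YBH}\bigl(\Theta_2\oplus(\Xi^{\rm YI}_2-\Omega^{\rm YI}_2)\oplus(\Xi^{\rm IY}_2-\Omega^{\rm IY}_2)\oplus\Lambda_2\bigr)=0.$$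
   Context: $\otimes=\otimes_{\mathbb{k}}$, $\mathrm{Hom}=\mathrm{Hom}_{\mathbb{k}}$, and $1$ denotes the identity map of $V$. A Yang-Baxter (YB) operator on a $\mathbb{k}$-module $V$ is an invertible map $R:V\otimes V\to V\otimes V$ with $(R\otimes 1)(1\otimes R)(R\otimes 1)=(1\otimes R)(R\otimes 1)(1\otimes R)$. A braided algebra $(V,\mu,R)$ is an associative $\mathbb{k}$-algebra $(V,\mu)$ with a YB operator $R$ on $V$ satisfying (YI) $(1\otimes\mu)(R\otimes 1)(1\otimes R)=R(\mu\otimes 1)$ and (IY) $(\mu\otimes 1)(1\otimes R)(R\otimes 1)=R(1\otimes\mu)$. The same definition applies over other commutative rings. An infinitesimal deformation is a braided algebra structure $(\mu+\hbar\psi_1,R+\hbar\phi_1)$ over $\mathbb{k}[[\hbar]]/(\hbar^2)$ on $V\otimes\mathbb{k}[[\hbar]]/(\hbar^2)$, with $\psi_1\in\mathrm{Hom}(V^{\otimes 2},V)$, $\phi_1\in\mathrm{Hom}(V^{\otimes 2},V^{\otimes 2})$. A quadratic deformation extending it is a braided algebra structure $(\mu+\hbar\psi_1+\hbar^2\psi_2,\ R+\hbar\phi_1+\hbar^2\phi_2)$ over $\mathbb{k}[[\hbar]]/(\hbar^3)$ on $V\otimes\mathbb{k}[[\hbar]]/(\hbar^3)$. Obstruction terms: put $\psi_0=\mu$, $\phi_0=R$, $\Gamma_2=\{(1,1,0),(1,0,1),(0,1,1)\}$, and $\Theta_2=\sum_{(i,j,k)\in\Gamma_2}[(\phi_i\otimes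 1)(1\otimes\phi_j)(\phi_k\otimes 1)-(1\otimes\phi_i)(\phi_j\otimes 1)(1\otimes\phi_k)]$; $\Xi^{\rm YI}_2=\sum_{(i,j,k)\in\Gamma_2}(1\otimes\psi_i)(\phi_j\otimes 1)(1\otimes\phi_k)$, $\Omega^{\rm YI}_2=\phi_1(\psi_1\otimes 1)$; $\Xi^{\rm IY}_2=\sum_{(i,j,k)\in\Gamma_2}(\psi_i\otimes 1)(1\otimes\phi_j)(\phi_k\otimes 1)$, $\Omega^{\rm IY}_2=\phi_1(1\otimes\psi_1)$; $\Lambda_2=\psi_1(\psi_1\otimes 1)-\psi_1(1\otimes\psi_1)$. Cochains: $C^2_{\rm YBH}(V,V)=\mathrm{Hom}(V^{\otimes 2},V^{\otimes 2})\oplus\mathrm{Hom}(V^{\otimes 2},V)$ (elements $\phi\oplus\psi$), and $C^3_{\rm YBH}(V,V)=\mathrm{Hom}(V^{\otimes 3},V^{\otimes 3})\oplus C^{3,2}_{\rm YI}\oplus C^{3,2}_{\rm IY}\oplus\mathrm{Hom}(V^{\otimes 3},V)$ with $C^{3,2}_{\rm YI}=C^{3,2}_{\rm IY}=\mathrm{Hom}(V^{\otimes 3},V^{\otimes 2})$ (elements $\beta\oplus\alpha\oplus\alpha'\oplus\gamma$). Second differential: $\delta^2_{\rm YBH}(\phi\oplus\psi)=\delta^2_{\rm YB}(\phi)\oplus\delta^2_{\rm YI}(\phi\oplus\psi)\oplus\delta^2_{\rm IY}(\phi\oplus\psi)\oplus\delta^2_{\rm H}(\psi)$, where $\delta^2_{\rm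 YB}(\phi)=(R\otimes 1)(1\otimes R)(\phi\otimes 1)+(R\otimes 1)(1\otimes\phi)(R\otimes 1)+(\phi\otimes 1)(1\otimes R)(R\otimes 1)-(1\otimes R)(R\otimes 1)(1\otimes\phi)-(1\otimes R)(\phi\otimes 1)(1\otimes R)-(1\otimes\phi)(R\otimes 1)(1\otimes R)$; $\delta^2_{\rm H}(\psi)=\mu(\psi\otimes 1)+\psi(\mu\otimes 1)-\mu(1\otimes\psi)-\psi(1\otimes\mu)$; $\delta^2_{\rm YI}(\phi\oplus\psi)=(1\otimes\psi)(R\otimes 1)(1\otimes R)+(1\otimes\mu)(\phi\otimes 1)(1\otimes R)+(1\otimes\mu)(R\otimes 1)(1\otimes\phi)-R(\psi\otimes 1)-\phi(\mu\otimes 1)$; $\delta^2_{\rm IY}(\phi\oplus\psi)=(\psi\otimes 1)(1\otimes R)(R\otimes 1)+(\mu\otimes 1)(1\otimes\phi)(R\otimes 1)+(\mu\otimes 1)(1\otimes R)(\phi\otimes 1)-R(1\otimes\psi)-\phi(1\otimes\mu)$. Third differential: on $V^{\otimes 4}$ write $R_1=R\otimes 1^{\otimes 2}$, $R_2=1\otimes R\otimes 1$, $R_3=1^{\otimes 2}\otimes R$, $\beta_1=\beta\otimes 1$, $\beta_2=1\otimes\beta$. Then $\delta^3_{\rm YBH}(\beta\oplus\alpha\oplus\alpha'\oplus\gamma)$ is the tuple with components $\delta^3_{\rm YB}(\beta)\in\mathrm{Hom}(V^{\otimes 4},V^{\otimes 4})$; $\delta^{3,1}_{\rm YI}(\beta\oplus\alpha),\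 \delta^{3,1}_{\rm IY}(\beta\oplus\alpha')\in\mathrm{Hom}(V^{\otimes 4},V^{\otimes 3})$; $\delta^{3,2}_{\rm YI}(\alpha\oplus\alpha'),\ \delta^{3,3}_{\rm YI}(\alpha\oplus\gamma),\ \delta^{3,3}_{\rm IY}(\alpha'\oplus\gamma)\in\mathrm{Hom}(V^{\otimes 4},V^{\otimes 2})$; $\delta^3_{\rm H}(\gamma)\in\mathrm{Hom}(V^{\otimes 4},V)$, where $\delta^3_{\rm YB}(\beta)=\beta_1R_3R_2R_1+R_2R_1\beta_2R_1+R_2R_3\beta_1R_3+\beta_2R_1R_2R_3-R_1R_2R_3\beta_1-R_1\beta_2R_1R_2-R_3\beta_1R_3R_2-R_3R_2R_1\beta_2$; $\delta^{3,1}_{\rm YI}(\beta\oplus\alpha)=(1\otimes R)(\alpha\otimes 1)R_3+(1\otimes\alpha)R_1R_2R_3+(1^{\otimes 2}\otimes\mu)R_2R_1\beta_2+(1^{\otimes 2}\otimes\mu)\beta_1R_3R_2-\beta(\mu\otimes 1^{\otimes 2})-(R\otimes 1)(1\otimes R)(\alpha\otimes 1)-(R\otimes 1)(1\otimes\alpha)R_1R_2$; $\delta^{3,1}_{\rm IY}(\beta\oplus\alpha')=(R\otimes 1)(1\otimes\alpha')R_1+(\alpha'\otimes 1)R_3R_2R_1-(\mu\otimes 1^{\otimes 2})R_2R_3\beta_1-(\mu\otimes 1^{\otimes 2})\beta_2R_1R_2+\beta(1^{\otimes 2}\otimes\mu)-(1\otimes R)(R\otimes 1)(1\otimes\alpha')-(1\otimes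 R)(\alpha'\otimes 1)R_3R_2$; $\delta^{3,2}_{\rm YI}(\alpha\oplus\alpha')=\alpha'(\mu\otimes 1^{\otimes 2})+(\mu\otimes 1)(1\otimes R)(\alpha\otimes 1)+(\mu\otimes 1)(1\otimes\alpha)R_1R_2-\alpha(1^{\otimes 2}\otimes\mu)-(1\otimes\mu)(R\otimes 1)(1\otimes\alpha')-(1\otimes\mu)(\alpha'\otimes 1)R_3R_2$; $\delta^{3,3}_{\rm YI}(\alpha\oplus\gamma)=R(\gamma\otimes 1)+\alpha(\mu\otimes 1^{\otimes 2})+(1\otimes\mu)(\alpha\otimes 1)R_3-\alpha(1\otimes\mu\otimes 1)-(1\otimes\mu)(R\otimes 1)(1\otimes\alpha)-(1\otimes\gamma)R_1R_2R_3$; $\delta^{3,3}_{\rm IY}(\alpha'\oplus\gamma)=-R(1\otimes\gamma)+\alpha'(1^{\otimes 2}\otimes\mu)+(\mu\otimes 1)(1\otimes\alpha')R_1-\alpha'(1\otimes\mu\otimes 1)-(\mu\otimes 1)(1\otimes R)(\alpha'\otimes 1)+(\gamma\otimes 1)R_3R_2R_1$; $\delta^3_{\rm H}(\gamma)=\mu(\gamma\otimes 1)+\mu(1\otimes\gamma)+\gamma(1\otimes\mu\otimes 1)-\gamma(\mu\otimes 1^{\otimes 2})-\gamma(1^{\otimes 2}\otimes\mu)$. $H^3_{\rm YBH}(V,V)=\ker\delta^3_{\rm YBH}/\mathrm{Im}\,\delta^2_{\rm YBH}$. *)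

(* Defs.v *)
From HB Require Import structures.
From mathcomp Require Import all_boot ssralg poly qpoly generic_quotient boolp.

Set Implicit Arguments.
Unset Strict Implicit.
Unset Printing Implicit Defensive.

Import GRing.Theory.
Local Open Scope ring_scope.
Local Open Scope quotient_scope.

Reserved Notation "f ∘ g" (at level 40, left associativity).
Reserved Notation "V ^⊗ n" (at level 29, left associativity, n at level 9, format "V ^⊗ n").

Section LinearMaps.
Variables (k : comNzRingType) (U V : lmodType k).

HB.instance Definition _ := gen_eqMixin {linear U -> V}.
HB.instance Definition _ := gen_choiceMixin {linear U -> V}.

Lemma linP (f g : {linear U -> V}) : f =1 g -> f = g.
Proof.
case: f g => [f fL] [g gL] /= /funext fg; subst g; congr GRing.Linear.Pack.
by case: fL gL => [[fA]] [fS] [[gA]] [gS]; rewrite (Prop_irrelevance fA gA)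
  (Prop_irrelevance fS gS).
Qed.

Definition lin_zero : {linear U -> V} := \0.
Definition lin_add (f g : {linear U -> V}) : {linear U -> V} := f \+ g.
Definition lin_opp (f : {linear U -> V}) : {linear U -> V} := \- f.
Definition lin_scale (a : k) (f : {linear U -> V}) : {linear U -> V} := a \*: f.

Fact lin_addA : associative lin_add.
Proof. by move=> f g h; apply: linP => x /=; rewrite addrA. Qed.
Fact lin_addC : commutative lin_add.
Proof. by move=> f g; apply: linP => x /=; rewrite addrC. Qed.
Fact lin_add0 : left_id lin_zero lin_add.
Proof. by move=> f; apply: linP => x /=; rewrite add0r. Qed.
Fact lin_addN : left_inverse lin_zero lin_opp lin_add.
Proof. by move=> f; apply: linP => x /=; rewrite addNr. Qed.

HB.instance Definition _ :=
  GRing.isZmodule.Build {linear U -> V} lin_addA lin_addC lin_add0 lin_addN.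

Fact lin_scaleA a b f : lin_scale a (lin_scale b f) = lin_scale (a * b) f.
Proof. by apply: linP => x /=; rewrite scalerA. Qed.
Fact lin_scale1 : left_id 1 lin_scale.
Proof. by move=> f; apply: linP => x /=; rewrite scale1r. Qed.
Fact lin_scaleDr : right_distributive lin_scale +%R.
Proof. by move=> a f g; apply: linP => x /=; rewrite scalerDr. Qed.
Fact lin_scaleDl f : {morph lin_scale^~ f : a b / a + b}.
Proof. by move=> a b; apply: linP => x /=; rewrite scalerDl. Qed.

HB.instance Definition _ :=
  GRing.Zmodule_isLmodule.Build k {linear U -> V}
    lin_scaleA lin_scale1 lin_scaleDr lin_scaleDl.

Lemma linDE (f g : {linear U -> V}) x : (f + g) x = f x + g x.
Proof. by []. Qed.
Lemma linNE (f : {linear U -> V}) x : (- f) x = - f x.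
Proof. by []. Qed.
Lemma linZE a (f : {linear U -> V}) x : (a *: f) x = a *: f x.
Proof. by []. Qed.

End LinearMaps.

Definition lin_comp (k : comNzRingType) (U V W : lmodType k)
  (f : {linear V -> W}) (g : {linear U -> V}) : {linear U -> W} :=
  (f \o g)%FUN.
Notation "f ∘ g" := (lin_comp f g) : ring_scope.

Definition lin_id (k : comNzRingType) (U : lmodType k) : {linear U -> U} :=
  idfun.
Arguments lin_id {k} U.

(* The tensor product of U and V over k consists of the finite formal sums    *)
(* of pairs (u, v), two of them being identified when no balanced map         *)
(* separates them. Hence every balanced map factors uniquely through it,      *)
(* which is the universal property of the quotient of the free module on      *)
(* U * V by the bilinearity relations.                                        *)
Section TensorProduct.
Variables (k : comNzRingType) (U V : lmodType k).

Record balanced (Z : zmodType) (f : U -> V -> Z) : Prop := Balanced {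
  balDl : forall u u' v, f (u + u') v = f u v + f u' v;
  balDr : forall u v v', f u (v + v') = f u v + f u v';
  balZ : forall a u v, f (a *: u) v = f u (a *: v) }.

Definition fsum (Z : zmodType) (f : U -> V -> Z) (s : seq (U * V)) : Z :=
  \sum_(p <- s) f p.1 p.2.

Definition tens_rel (s t : seq (U * V)) : bool :=
  `[< forall (Z : zmodType) (f : U -> V -> Z),
        balanced f -> fsum f s = fsum f t >].

Fact tens_rel_refl : reflexive tens_rel.
Proof. by move=> s; apply/asboolP. Qed.
Fact tens_rel_sym : symmetric tens_rel.
Proof.
by move=> s t; apply/asboolP/asboolP => st Z f bf; rewrite st.
Qed.
Fact tens_rel_trans : transitive tens_rel.
Proof.
move=> t s r /asboolP st /asboolP tr; apply/asboolP => Z f bf.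
by rewrite st ?tr.
Qed.
Canonical tens_equiv := EquivRel tens_rel tens_rel_refl tens_rel_sym tens_rel_trans.

Definition tensor_sort : Type := {eq_quot tens_rel}.
HB.instance Definition _ := Choice.on tensor_sort.

Definition tens_class (s : seq (U * V)) : tensor_sort := \pi_({eq_quot tens_rel}) s.
Definition tens_repr (x : tensor_sort) : seq (U * V) := repr (x : {eq_quot tens_rel}).

Definition tlift_fun (Z : zmodType) (f : U -> V -> Z) (x : tensor_sort) : Z :=
  fsum f (tens_repr x).

Lemma tlift_class (Z : zmodType) (f : U -> V -> Z) s :
  balanced f -> tlift_fun f (tens_class s) = fsum f s.
Proof.
move=> bf; rewrite /tlift_fun /tens_repr /tens_class.
have /eqmodP/asboolP : repr (\pi_({eq_quot tens_rel}) s) = s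
  %[mod {eq_quot tens_rel}] by rewrite reprK.
exact.
Qed.

Lemma tens_eqP (x y : tensor_sort) :
  (forall (Z : zmodType) (f : U -> V -> Z), balanced f ->
     tlift_fun f x = tlift_fun f y) -> x = y.
Proof.
move=> xy; rewrite -[x]reprK -[y]reprK; apply/eqmodP/asboolP => Z f bf.
exact: xy.
Qed.

Definition tens_zero : tensor_sort := tens_class [::].
Definition tens_add (x y : tensor_sort) : tensor_sort :=
  tens_class (tens_repr x ++ tens_repr y).
Definition tens_scale (a : k) (x : tensor_sort) : tensor_sort :=
  tens_class [seq (a *: p.1, p.2) | p <- tens_repr x].
Definition tens_opp (x : tensor_sort) : tensor_sort := tens_scale (-1) x.

Lemma tlift_zero (Z : zmodType) (f : U -> V -> Z) : balanced f -> tlift_fun f tens_zero = 0.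
Proof. by move=> bf; rewrite tlift_class // /fsum big_nil. Qed.
Lemma tlift_add (Z : zmodType) (f : U -> V -> Z) x y : balanced f ->
  tlift_fun f (tens_add x y) = tlift_fun f x + tlift_fun f y.
Proof. by move=> bf; rewrite tlift_class // /fsum big_cat. Qed.
Lemma tlift_scale (Z : zmodType) (f : U -> V -> Z) a x : balanced f ->
  tlift_fun f (tens_scale a x) = tlift_fun (fun u v => f (a *: u) v) x.
Proof. by move=> bf; rewrite tlift_class // /fsum big_map. Qed.

Lemma balanced_scale (Z : zmodType) (f : U -> V -> Z) a :
  balanced f -> balanced (fun u v => f (a *: u) v).
Proof.
move=> bf; split=> [u u' v|u v v'|b u v].
- by rewrite scalerDr (balDl bf).
- by rewrite (balDr bf).
- by rewrite scalerA mulrC -scalerA (balZ bf).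
Qed.

Lemma balN (Z : zmodType) (f : U -> V -> Z) u v : balanced f -> f (- u) v = - f u v.
Proof.
move=> bf; have f0 : f 0 v = 0.
  by apply: (@addrI _ (f 0 v)); rewrite -(balDl bf) !addr0.
by apply/eqP; rewrite -addr_eq0 -(balDl bf) addNr f0.
Qed.

Fact tens_addA : associative tens_add.
Proof.
by move=> x y z; apply: tens_eqP => Z f bf; rewrite !tlift_add // addrA.
Qed.
Fact tens_addC : commutative tens_add.
Proof.
by move=> x y; apply: tens_eqP => Z f bf; rewrite !tlift_add // addrC.
Qed.
Fact tens_add0 : left_id tens_zero tens_add.
Proof.
move=> x; apply: tens_eqP => Z f bf.
by rewrite tlift_add // tlift_zero // add0r.
Qed.
Fact tens_addN : left_inverse tens_zero tens_opp tens_add.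
Proof.
move=> x; apply: tens_eqP => Z f bf.
rewrite tlift_add // tlift_zero // tlift_scale // /tlift_fun /fsum -big_split.
by rewrite big1 // => p _ /=; rewrite scaleN1r balN // addNr.
Qed.
HB.instance Definition _ :=
  GRing.isZmodule.Build tensor_sort tens_addA tens_addC tens_add0 tens_addN.

Fact tens_scaleA a b x : tens_scale a (tens_scale b x) = tens_scale (a * b) x.
Proof.
apply: tens_eqP => Z f bf.
rewrite tlift_scale // tlift_scale; last exact: balanced_scale.
rewrite tlift_scale // /tlift_fun /fsum.
by apply: eq_bigr => p _; rewrite scalerA.
Qed.
Fact tens_scale1 : left_id 1 tens_scale.
Proof.
move=> x; apply: tens_eqP => Z f bf; rewrite tlift_scale // /tlift_fun /fsum.
by apply: eq_bigr => p _; rewrite scale1r.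
Qed.
Fact tens_scaleDr : right_distributive tens_scale +%R.
Proof.
move=> a x y; apply: tens_eqP => Z f bf; have baf := balanced_scale a bf.
by rewrite tlift_add // !tlift_scale // tlift_add.
Qed.
Fact tens_scaleDl x : {morph tens_scale^~ x : a b / a + b}.
Proof.
move=> a b; apply: tens_eqP => Z f bf.
rewrite tlift_add // !tlift_scale // /tlift_fun /fsum -big_split.
by apply: eq_bigr => p _; rewrite scalerDl (balDl bf).
Qed.
HB.instance Definition _ :=
  GRing.Zmodule_isLmodule.Build k tensor_sort
    tens_scaleA tens_scale1 tens_scaleDr tens_scaleDl.

Definition tensor : lmodType k := tensor_sort.

Definition tens (u : U) (v : V) : tensor := tens_class [:: (u, v)].

Lemma tlift_tens (Z : zmodType) (f : U -> V -> Z) u v :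
  balanced f -> tlift_fun f (tens u v) = f u v.
Proof. by move=> bf; rewrite tlift_class // /fsum big_seq1. Qed.
Lemma tliftD (Z : zmodType) (f : U -> V -> Z) (x y : tensor) :
  balanced f -> tlift_fun f (x + y) = tlift_fun f x + tlift_fun f y.
Proof. exact: tlift_add. Qed.

Lemma tensDl u u' v : tens (u + u') v = tens u v + tens u' v.
Proof.
by apply: tens_eqP => Z f bf; rewrite tliftD // !tlift_tens // (balDl bf).
Qed.
Lemma tensDr u v v' : tens u (v + v') = tens u v + tens u v'.
Proof.
by apply: tens_eqP => Z f bf; rewrite tliftD // !tlift_tens // (balDr bf).
Qed.
Lemma tensZl a u v : tens (a *: u) v = a *: tens u v.
Proof.
apply: tens_eqP => Z f bf; rewrite tlift_scale //.
by rewrite !tlift_tens //; exact: balanced_scale.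
Qed.
Lemma tensZr a u v : tens u (a *: v) = a *: tens u v.
Proof.
apply: tens_eqP => Z f bf; rewrite tlift_scale //.
rewrite !tlift_tens ?(balZ bf) //; exact: balanced_scale.
Qed.
Lemma tens_balanced : balanced tens.
Proof.
by split=> [u u' v|u v v'|a u v]; rewrite ?tensDl ?tensDr ?tensZl ?tensZr.
Qed.

Lemma tens_sumE (x : tensor) : x = \sum_(p <- tens_repr x) tens p.1 p.2.
Proof.
apply: tens_eqP => Z f bf; rewrite [LHS]/tlift_fun /fsum.
elim: (tens_repr x) => [|p s IHs]; first by rewrite !big_nil tlift_zero.
by rewrite !big_cons tliftD // tlift_tens // IHs.
Qed.

Lemma tens_ind (P : tensor -> Prop) :
  (forall u v, P (tens u v)) -> (forall x y, P x -> P y -> P (x + y)) ->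
  forall x, P x.
Proof.
move=> Pt PD x; rewrite [x]tens_sumE; elim: (tens_repr x) => [|p s IHs].
  by rewrite big_nil -[X in P X](scale0r (tens 0 0)) -tensZl.
by rewrite big_cons; apply: PD.
Qed.

Fact tens_linear u : linear (tens u).
Proof. by move=> a v v'; rewrite tensDr tensZr. Qed.
HB.instance Definition _ u :=
  GRing.isLinear.Build k V tensor *:%R (tens u) (tens_linear u).
Definition tensl (u : U) : {linear V -> tensor} := tens u.

Definition tensr_fun v u := tens u v.
Fact tensr_linear v : linear (tensr_fun v).
Proof. by move=> a u u'; rewrite /tensr_fun tensDl tensZl. Qed.
HB.instance Definition _ v :=
  GRing.isLinear.Build k U tensor *:%R (tensr_fun v) (tensr_linear v).
Definition tensr (v : V) : {linear U -> tensor} := tensr_fun v.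

End TensorProduct.

Arguments tensor {k} U V.
Arguments tensl {k U} V u.
Arguments tensr {k} U {V} v.

Section TensorLift.
Variables (k : comNzRingType) (U V M : lmodType k) (f : U -> V -> M).
Hypotheses (bf : balanced f) (Zf : forall a u v, f (a *: u) v = a *: f u v).

Fact tlift_linear : linear (tlift_fun f).
Proof.
move=> a x y; rewrite tliftD //; congr (_ + _).
rewrite tlift_scale // /tlift_fun /fsum scaler_sumr.
by apply: eq_bigr => p _.
Qed.

Definition tlift : {linear tensor U V -> M} :=
  HB.pack (tlift_fun f)
    (GRing.isLinear.Build k (tensor U V) M *:%R (tlift_fun f) tlift_linear).

Lemma tliftE u v : tlift (tens u v) = f u v.
Proof. exact: tlift_tens. Qed.

Lemma tlift_uniq (g : {linear tensor U V -> M}) :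
  (forall u v, g (tens u v) = f u v) -> g = tlift.
Proof.
move=> gE; apply: linP; elim/tens_ind => [u v|x y gx gy].
  by rewrite gE tliftE.
by rewrite !linearD gx gy.
Qed.

End TensorLift.

Section TensorMap.
Variables (k : comNzRingType) (U V U' V' : lmodType k).
Variables (f : {linear U -> U'}) (g : {linear V -> V'}).

Definition tmap_fun u v : tensor U' V' := tens (f u) (g v).
Fact tmap_balanced : balanced tmap_fun.
Proof.
split=> [u u' v|u v v'|a u v]; rewrite /tmap_fun.
- by rewrite linearD tensDl.
- by rewrite linearD tensDr.
- by rewrite !linearZ /= tensZl.
Qed.
Fact tmap_scale a u v : tmap_fun (a *: u) v = a *: tmap_fun u v.
Proof. by rewrite /tmap_fun linearZ tensZl. Qed.
Definition tmap : {linear tensor U V -> tensor U' V'} :=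
  tlift tmap_balanced tmap_scale.

Lemma tmapE u v : tmap (tens u v) = tens (f u) (g v).
Proof. exact: tliftE. Qed.

End TensorMap.

Section Associativity.
Variables (k : comNzRingType) (U V W : lmodType k).

Definition tassoc_fun (x : tensor U V) (w : W) : tensor U (tensor V W) :=
  tmap (lin_id U) (tensr V w) x.
Fact tassoc_balanced : balanced tassoc_fun.
Proof.
split=> [x x' w|x w w'|a x w]; rewrite /tassoc_fun; first by rewrite linearD.
- elim/tens_ind: x => [u v|x y IHx IHy]; last first.
    by rewrite !linearD IHx IHy addrACA.
  by rewrite !tmapE /= /tensr_fun !tensDr.
- rewrite linearZZ; elim/tens_ind: x => [u v|x y IHx IHy]; last first.
    by rewrite !(scalerDr, linearD) IHx IHy.
  by rewrite !tmapE /= /tensr_fun !tensZr.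
Qed.
Fact tassoc_scale a x w : tassoc_fun (a *: x) w = a *: tassoc_fun x w.
Proof. by rewrite /tassoc_fun linearZZ. Qed.
Definition tassoc :
    {linear tensor (tensor U V) W -> tensor U (tensor V W)} :=
  tlift tassoc_balanced tassoc_scale.

Lemma tassocE u v w : tassoc (tens (tens u v) w) = tens u (tens v w).
Proof. by rewrite tliftE /tassoc_fun tmapE. Qed.

Definition tassoc_inv_fun (u : U) (x : tensor V W) : tensor (tensor U V) W :=
  tmap (tensl V u) (lin_id W) x.
Fact tassoc_inv_scale a u x :
  tassoc_inv_fun (a *: u) x = a *: tassoc_inv_fun u x.
Proof.
rewrite /tassoc_inv_fun; elim/tens_ind: x => [v w|x y IHx IHy]; last first.
  by rewrite !(scalerDr, linearD) IHx IHy.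
by rewrite !tmapE /= !tensZl.
Qed.
Fact tassoc_inv_balanced : balanced tassoc_inv_fun.
Proof.
split=> [u u' x|u x x'|a u x]; last 2 first.
- by rewrite /tassoc_inv_fun linearD.
- by rewrite tassoc_inv_scale /tassoc_inv_fun linearZZ.
rewrite /tassoc_inv_fun; elim/tens_ind: x => [v w|x y IHx IHy]; last first.
  by rewrite !linearD IHx IHy addrACA.
by rewrite !tmapE /= !tensDl.
Qed.
Definition tassoc_inv :
    {linear tensor U (tensor V W) -> tensor (tensor U V) W} :=
  tlift tassoc_inv_balanced tassoc_inv_scale.

Lemma tassoc_invE u v w : tassoc_inv (tens u (tens v w)) = tens (tens u v) w.
Proof. by rewrite tliftE /tassoc_inv_fun tmapE. Qed.

End Associativity.

(* Tensor powers are left-nested; V^⊗1 reduces to V and V^⊗2 to               *)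
(* tensor V V.                                                                *)
Fixpoint tpow (k : comNzRingType) (V : lmodType k) (n : nat) : lmodType k :=
  if n is m.+1 then (if m is 0 then V else tensor (tpow V m) V) else k^o.
Notation "V ^⊗ n" := (tpow V n) : type_scope.

Section Whiskering.
Variables (k : comNzRingType) (V : lmodType k).

(* The canonical isomorphism between V ⊗ V^⊗n and V^⊗(n+1), for n > 0.        *)
Fixpoint tcons (n : nat) : {linear tensor V (V ^⊗ n.+1) -> V ^⊗ n.+2} :=
  if n is m.+1 then tmap (tcons m) (lin_id V) ∘ tassoc_inv V (V ^⊗ m.+1) V
  else lin_id (tensor V V).
Fixpoint tuncons (n : nat) : {linear V ^⊗ n.+2 -> tensor V (V ^⊗ n.+1)} :=
  if n is m.+1 then tassoc V (V ^⊗ m.+1) V ∘ tmap (tuncons m) (lin_id V)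
  else lin_id (tensor V V).

(* tr f is f ⊗ 1 and tl f is 1 ⊗ f.                                           *)
Definition tr (m n : nat) (f : {linear V ^⊗ m.+1 -> V ^⊗ n.+1}) :
    {linear V ^⊗ m.+2 -> V ^⊗ n.+2} :=
  tmap f (lin_id V).
Definition tl (m n : nat) (f : {linear V ^⊗ m.+1 -> V ^⊗ n.+1}) :
    {linear V ^⊗ m.+2 -> V ^⊗ n.+2} :=
  tcons n ∘ tmap (lin_id V) f ∘ tuncons m.

End Whiskering.

Section BraidedAlgebra.
Variables (k : comNzRingType) (V : lmodType k).

Definition yang_baxter_operator (R : {linear V ^⊗ 2 -> V ^⊗ 2}) : Prop :=
  (exists S : {linear V ^⊗ 2 -> V ^⊗ 2},
     S ∘ R = lin_id (V ^⊗ 2) /\ R ∘ S = lin_id (V ^⊗ 2)) /\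
  tr R ∘ tl R ∘ tr R = tl R ∘ tr R ∘ tl R.

(* The algebra (V, mu) is associative but not required to be unital.          *)
Definition braided_algebra (mu : {linear V ^⊗ 2 -> V ^⊗ 1})
    (R : {linear V ^⊗ 2 -> V ^⊗ 2}) : Prop :=
  [/\ mu ∘ tr mu = mu ∘ tl mu,
      yang_baxter_operator R,
      tl mu ∘ tr R ∘ tl R = R ∘ tr mu &
      tr mu ∘ tl R ∘ tr R = R ∘ tl mu].

End BraidedAlgebra.

(* Extension of scalars along a commutative k-algebra A: V ⊗ A with A acting  *)
(* on the second factor.                                                      *)
Section BaseChange.
Variables (k : comNzRingType) (A : comAlgType k).

Definition bchange_sort (V : lmodType k) : Type := tensor V A.

Section Module.
Variable V : lmodType k.

HB.instance Definition _ := GRing.Zmodule.on (bchange_sort V).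

Definition bchange_scale (a : A) (x : bchange_sort V) : bchange_sort V :=
  tmap (lin_id V) (a \*o idfun)%R x.

Lemma bchange_scaleE a v b :
  bchange_scale a (tens v b) = tens v (a * b) :> tensor V A.
Proof. exact: tmapE. Qed.

Fact bchange_scaleDr : right_distributive bchange_scale +%R.
Proof. by move=> a x y; rewrite /bchange_scale linearD. Qed.
Fact bchange_scaleA a b x :
  bchange_scale a (bchange_scale b x) = bchange_scale (a * b) x.
Proof.
elim/tens_ind: x => [v c|x y IHx IHy].
  by rewrite !bchange_scaleE mulrA.
by rewrite !bchange_scaleDr IHx IHy.
Qed.
Fact bchange_scale1 : left_id 1 bchange_scale.
Proof.
elim/tens_ind => [v c|x y IHx IHy]; first by rewrite bchange_scaleE mul1r.
by rewrite bchange_scaleDr IHx IHy.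
Qed.
Fact bchange_scaleDl x : {morph bchange_scale^~ x : a b / a + b}.
Proof.
move=> a b; elim/tens_ind: x => [v c|x y IHx IHy].
  by rewrite /= !bchange_scaleE mulrDl tensDr.
by rewrite /= !bchange_scaleDr IHx IHy addrACA.
Qed.
HB.instance Definition _ :=
  GRing.Zmodule_isLmodule.Build A (bchange_sort V)
    bchange_scaleA bchange_scale1 bchange_scaleDr bchange_scaleDl.

Definition bchange : lmodType A := bchange_sort V.

Definition btens (v : V) (a : A) : bchange := tens v a.

Lemma btensDl v v' a : btens (v + v') a = btens v a + btens v' a.
Proof. exact: tensDl. Qed.
Lemma btensZ a v b : a *: btens v b = btens v (a * b).
Proof. exact: bchange_scaleE. Qed.
Lemma btens_ind (P : bchange -> Prop) :
  (forall v a, P (btens v a)) -> (forall x y, P x -> P y -> P (x + y)) ->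
  forall x, P x.
Proof. exact: tens_ind. Qed.

End Module.

Definition bmap_fun (U V : lmodType k) (f : {linear U -> V}) :
  bchange U -> bchange V := tmap f (lin_id A).
Fact bmap_funE (U V : lmodType k) (f : {linear U -> V}) u a :
  bmap_fun f (btens u a) = btens (f u) a.
Proof. exact: tmapE. Qed.
Fact bmap_funD (U V : lmodType k) (f : {linear U -> V}) x y :
  bmap_fun f (x + y) = bmap_fun f x + bmap_fun f y.
Proof. exact: linearD. Qed.
Fact bmap_linear (U V : lmodType k) (f : {linear U -> V}) : linear (bmap_fun f).
Proof.
move=> a x y; rewrite bmap_funD; congr (_ + _).
elim/btens_ind: x => [u b|x x' IHx IHx'].
  by rewrite btensZ !bmap_funE btensZ.
by rewrite scalerDr !bmap_funD IHx IHx' scalerDr.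
Qed.
Definition bmap (U V : lmodType k) (f : {linear U -> V}) :
    {linear bchange U -> bchange V} :=
  HB.pack (bmap_fun f)
    (GRing.isLinear.Build A (bchange U) (bchange V) *:%R (bmap_fun f)
      (bmap_linear f)).

Lemma bmapE (U V : lmodType k) (f : {linear U -> V}) u a :
  bmap f (btens u a) = btens (f u) a.
Proof. exact: bmap_funE. Qed.

(* The canonical isomorphism between (U ⊗ A) ⊗_A (V ⊗ A) and (U ⊗ V) ⊗ A.     *)

Section Monoidal.
Variables U V : lmodType k.

Definition bmerge1_fun (x : bchange U) (v : V) (b : A) :
  bchange (tensor U V) := b *: bmap (tensr U v) x.
Fact bmerge1_balanced x : balanced (bmerge1_fun x).
Proof.
split=> [v v' b|v b b'|c v b]; rewrite /bmerge1_fun; last 2 first.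
- by rewrite scalerDl.
- elim/btens_ind: x => [u a|x y IHx IHy]; last first.
    by rewrite !(scalerDr, linearD) IHx IHy.
  by rewrite !bmapE !btensZ /= /tensr_fun tensZr /btens tensZl -tensZr scalerAl.
rewrite -scalerDr; congr (_ *: _).
elim/btens_ind: x => [u a|x y IHx IHy]; last first.
  by rewrite !linearD IHx IHy addrACA.
by rewrite !bmapE /= /tensr_fun tensDr /btens tensDl.
Qed.

Definition bmerge_fun (x : bchange U) (y : bchange V) : bchange (tensor U V) :=
  tlift_fun (bmerge1_fun x) y.

Lemma bmerge_funE u a v b :
  bmerge_fun (btens u a) (btens v b) = btens (tens u v) (b * a).
Proof.
by rewrite /bmerge_fun tlift_tens ?/bmerge1_fun ?bmapE ?btensZ //;
  exact: bmerge1_balanced.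
Qed.

Fact bmerge_funDr x y y' : bmerge_fun x (y + y') = bmerge_fun x y + bmerge_fun x y'.
Proof. by apply: tliftD; apply: bmerge1_balanced. Qed.
Fact bmerge_funDl x x' y : bmerge_fun (x + x') y = bmerge_fun x y + bmerge_fun x' y.
Proof.
elim/btens_ind: y => [v b|y y' IHy IHy']; last first.
  by rewrite !bmerge_funDr IHy IHy' addrACA.
rewrite /bmerge_fun !tlift_tens; try exact: bmerge1_balanced.
by rewrite /bmerge1_fun linearD scalerDr.
Qed.
Fact bmerge_scale a x y : bmerge_fun (a *: x) y = a *: bmerge_fun x y.
Proof.
elim/btens_ind: x => [u c|x x' IHx IHx']; last first.
  by rewrite scalerDr !bmerge_funDl IHx IHx' scalerDr.
elim/btens_ind: y => [v b|y y' IHy IHy']; last first.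
  by rewrite !bmerge_funDr IHy IHy' scalerDr.
by rewrite btensZ !bmerge_funE btensZ mulrCA.
Qed.
Fact bmerge_balanced : balanced bmerge_fun.
Proof.
split; [exact: bmerge_funDl|exact: bmerge_funDr|move=> a x y].
elim/btens_ind: x => [u c|x x' IHx IHx']; last first.
  by rewrite scalerDr !bmerge_funDl IHx IHx'.
elim/btens_ind: y => [v b|y y' IHy IHy']; last first.
  by rewrite scalerDr !bmerge_funDr IHy IHy'.
by rewrite !btensZ !bmerge_funE mulrCA mulrA.
Qed.
Definition bmerge :
    {linear tensor (bchange U) (bchange V) -> bchange (tensor U V)} :=
  tlift bmerge_balanced bmerge_scale.

Lemma bmergeE u a v b :
  bmerge (tens (btens u a) (btens v b)) = btens (tens u v) (a * b).
Proof. by rewrite tliftE bmerge_funE mulrC. Qed.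

Definition bunit_fun (u : U) (v : V) : tensor (bchange U) (bchange V) :=
  tens (btens u 1) (btens v 1).

Lemma btensZl (W : lmodType k) c (w : W) a :
  btens (c *: w) a = c%:A *: btens w a.
Proof. by rewrite btensZ -scalerAl mul1r /btens tensZl tensZr. Qed.

Fact bunit_balanced : balanced bunit_fun.
Proof.
split=> [u u' v|u v v'|c u v]; rewrite /bunit_fun.
- by rewrite btensDl tensDl.
- by rewrite btensDl tensDr.
- by rewrite !btensZl tensZl tensZr.
Qed.

Definition bsplit_fun (x : tensor U V) (a : A) :
  tensor (bchange U) (bchange V) := a *: tlift_fun bunit_fun x.
Fact bsplit_balanced : balanced bsplit_fun.
Proof.
split=> [x x' a|x a a'|c x a]; rewrite /bsplit_fun.
- by rewrite tliftD ?scalerDr //; exact: bunit_balanced.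
- by rewrite scalerDl.
elim/tens_ind: x => [u v|x y IHx IHy]; last first.
  rewrite scalerDr !tliftD ?scalerDr ?IHx ?IHy //; exact: bunit_balanced.
rewrite -tensZl !tlift_tens; try exact: bunit_balanced.
by rewrite /bunit_fun btensZl tensZl scalerA mulr_algr.
Qed.
Definition bsplit_raw : bchange (tensor U V) -> tensor (bchange U) (bchange V) :=
  tlift_fun bsplit_fun.
Fact bsplit_linear : linear bsplit_raw.
Proof.
move=> a x y; rewrite /bsplit_raw tliftD; last exact: bsplit_balanced.
congr (_ + _); elim/btens_ind: x => [z b|x x' IHx IHx'].
  rewrite btensZ !tlift_tens; try exact: bsplit_balanced.
  by rewrite /bsplit_fun scalerA.
rewrite scalerDr !tliftD ?IHx ?IHx' ?scalerDr //; exact: bsplit_balanced.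
Qed.
Definition bsplit :
    {linear bchange (tensor U V) -> tensor (bchange U) (bchange V)} :=
  HB.pack bsplit_raw
    (GRing.isLinear.Build A _ _ *:%R bsplit_raw bsplit_linear).

Lemma bsplitE u v a :
  bsplit (btens (tens u v) a) = a *: tens (btens u 1) (btens v 1).
Proof.
rewrite [LHS]tlift_tens; last exact: bsplit_balanced.
by rewrite /bsplit_fun tlift_tens //; exact: bunit_balanced.
Qed.

Lemma bmergeK : cancel bmerge bsplit.
Proof.
elim/tens_ind => [x y|x y IHx IHy]; last by rewrite !linearD IHx IHy.
elim/btens_ind: x => [u a|x x' IHx IHx']; last first.
  by rewrite tensDl !linearD IHx IHx'.
elim/btens_ind: y => [v b|y y' IHy IHy']; last first.
  by rewrite tensDr !linearD IHy IHy'.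
rewrite bmergeE bsplitE -scalerA -tensZr -tensZl.
by rewrite !btensZ !mulr1.
Qed.
Lemma bsplitK : cancel bsplit bmerge.
Proof.
elim/btens_ind => [x a|x y IHx IHy]; last by rewrite !linearD IHx IHy.
elim/tens_ind: x => [u v|x y IHx IHy].
  by rewrite bsplitE linearZZ bmergeE btensZ !mulr1.
by rewrite btensDl !linearD IHx IHy.
Qed.

End Monoidal.

Variable V : lmodType k.

(* The A-linear extensions of psi and phi.                                    *)
Definition bextend21 (psi : {linear V ^⊗ 2 -> V ^⊗ 1}) :
    {linear (bchange V) ^⊗ 2 -> (bchange V) ^⊗ 1} :=
  bmap psi ∘ bmerge V V.
Definition bextend22 (phi : {linear V ^⊗ 2 -> V ^⊗ 2}) :
    {linear (bchange V) ^⊗ 2 -> (bchange V) ^⊗ 2} :=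
  bsplit V V ∘ bmap phi ∘ bmerge V V.

End BaseChange.

Section Deformation.
Variables (k : comNzRingType) (V : lmodType k).
Variables (mu : {linear V ^⊗ 2 -> V ^⊗ 1}) (R : {linear V ^⊗ 2 -> V ^⊗ 2}).

(* k[[h]] / (h^2) is k['X] / ('X^2), and h is the class 'qX of 'X.            *)
Definition infinitesimal_deformation
    (psi1 : {linear V ^⊗ 2 -> V ^⊗ 1}) (phi1 : {linear V ^⊗ 2 -> V ^⊗ 2}) :=
  let A : comAlgType k := {poly %/ ('X^2 : {poly k})} in
  let h : A := qpolyX ('X^2 : {poly k}) in
  braided_algebra (bextend21 A mu + h *: bextend21 A psi1)
                  (bextend22 A R + h *: bextend22 A phi1).

End Deformation.

Section Complex.
Variables (k : comNzRingType) (V : lmodType k).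
Variables (mu : {linear V ^⊗ 2 -> V ^⊗ 1}) (R : {linear V ^⊗ 2 -> V ^⊗ 2}).

Definition C3_YBH : lmodType k :=
  ({linear V ^⊗ 3 -> V ^⊗ 3} * {linear V ^⊗ 3 -> V ^⊗ 2} *
   {linear V ^⊗ 3 -> V ^⊗ 2} * {linear V ^⊗ 3 -> V ^⊗ 1})%type.
Definition C4_YBH : lmodType k :=
  ({linear V ^⊗ 4 -> V ^⊗ 4} * {linear V ^⊗ 4 -> V ^⊗ 3} *
   {linear V ^⊗ 4 -> V ^⊗ 3} * {linear V ^⊗ 4 -> V ^⊗ 2} *
   {linear V ^⊗ 4 -> V ^⊗ 2} * {linear V ^⊗ 4 -> V ^⊗ 2} *
   {linear V ^⊗ 4 -> V ^⊗ 1})%type.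

Let R1 : {linear V ^⊗ 4 -> V ^⊗ 4} := tr (tr R).
Let R2 : {linear V ^⊗ 4 -> V ^⊗ 4} := tr (tl R).
Let R3 : {linear V ^⊗ 4 -> V ^⊗ 4} := tl (tl R).
Let mu1 : {linear V ^⊗ 4 -> V ^⊗ 3} := tr (tr mu).
Let mu2 : {linear V ^⊗ 4 -> V ^⊗ 3} := tr (tl mu).
Let mu3 : {linear V ^⊗ 4 -> V ^⊗ 3} := tl (tl mu).

Definition delta3_YB (beta : {linear V ^⊗ 3 -> V ^⊗ 3}) :
    {linear V ^⊗ 4 -> V ^⊗ 4} :=
  let b1 := tr beta in let b2 := tl beta in
  b1 ∘ R3 ∘ R2 ∘ R1 + R2 ∘ R1 ∘ b2 ∘ R1
  + R2 ∘ R3 ∘ b1 ∘ R3 + b2 ∘ R1 ∘ R2 ∘ R3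
  - R1 ∘ R2 ∘ R3 ∘ b1 - R1 ∘ b2 ∘ R1 ∘ R2
  - R3 ∘ b1 ∘ R3 ∘ R2 - R3 ∘ R2 ∘ R1 ∘ b2.

Definition delta31_YI (beta : {linear V ^⊗ 3 -> V ^⊗ 3})
    (alpha : {linear V ^⊗ 3 -> V ^⊗ 2}) : {linear V ^⊗ 4 -> V ^⊗ 3} :=
  tl R ∘ tr alpha ∘ R3 + tl alpha ∘ R1 ∘ R2 ∘ R3
  + mu3 ∘ R2 ∘ R1 ∘ tl beta + mu3 ∘ tr beta ∘ R3 ∘ R2
  - beta ∘ mu1 - tr R ∘ tl R ∘ tr alpha - tr R ∘ tl alpha ∘ R1 ∘ R2.

Definition delta31_IY (beta : {linear V ^⊗ 3 -> V ^⊗ 3})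
    (alpha' : {linear V ^⊗ 3 -> V ^⊗ 2}) : {linear V ^⊗ 4 -> V ^⊗ 3} :=
  tr R ∘ tl alpha' ∘ R1 + tr alpha' ∘ R3 ∘ R2 ∘ R1
  - mu1 ∘ R2 ∘ R3 ∘ tr beta - mu1 ∘ tl beta ∘ R1 ∘ R2
  + beta ∘ mu3 - tl R ∘ tr R ∘ tl alpha' - tl R ∘ tr alpha' ∘ R3 ∘ R2.

Definition delta32_YI (alpha alpha' : {linear V ^⊗ 3 -> V ^⊗ 2}) :
    {linear V ^⊗ 4 -> V ^⊗ 2} :=
  alpha' ∘ mu1 + tr mu ∘ tl R ∘ tr alpha + tr mu ∘ tl alpha ∘ R1 ∘ R2
  - alpha ∘ mu3 - tl mu ∘ tr R ∘ tl alpha' - tl mu ∘ tr alpha' ∘ R3 ∘ R2.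

Definition delta33_YI (alpha : {linear V ^⊗ 3 -> V ^⊗ 2})
    (gamma : {linear V ^⊗ 3 -> V ^⊗ 1}) : {linear V ^⊗ 4 -> V ^⊗ 2} :=
  R ∘ tr gamma + alpha ∘ mu1 + tl mu ∘ tr alpha ∘ R3
  - alpha ∘ mu2 - tl mu ∘ tr R ∘ tl alpha - tl gamma ∘ R1 ∘ R2 ∘ R3.

Definition delta33_IY (alpha' : {linear V ^⊗ 3 -> V ^⊗ 2})
    (gamma : {linear V ^⊗ 3 -> V ^⊗ 1}) : {linear V ^⊗ 4 -> V ^⊗ 2} :=
  - (R ∘ tl gamma) + alpha' ∘ mu3 + tr mu ∘ tl alpha' ∘ R1
  - alpha' ∘ mu2 - tr mu ∘ tl R ∘ tr alpha' + tr gamma ∘ R3 ∘ R2 ∘ R1.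

Definition delta3_H (gamma : {linear V ^⊗ 3 -> V ^⊗ 1}) :
    {linear V ^⊗ 4 -> V ^⊗ 1} :=
  mu ∘ tr gamma + mu ∘ tl gamma + gamma ∘ mu2 - gamma ∘ mu1 - gamma ∘ mu3.

Definition delta3_YBH (c : C3_YBH) : C4_YBH :=
  let: (beta, alpha, alpha', gamma) := c in
  (delta3_YB beta, delta31_YI beta alpha, delta31_IY beta alpha',
   delta32_YI alpha alpha', delta33_YI alpha gamma, delta33_IY alpha' gamma,
   delta3_H gamma).

Section Obstruction.
Variables (psi1 : {linear V ^⊗ 2 -> V ^⊗ 1}) (phi1 : {linear V ^⊗ 2 -> V ^⊗ 2}).

Let psi_ (i : nat) := if i is 0 then mu else psi1.
Let phi_ (i : nat) := if i is 0 then R else phi1.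

Definition Gamma2 : seq (nat * nat * nat) :=
  [:: (1, 1, 0); (1, 0, 1); (0, 1, 1)]%N.

Definition Theta2 : {linear V ^⊗ 3 -> V ^⊗ 3} :=
  \sum_(t <- Gamma2) let: (i, j, l) := t in
    (tr (phi_ i) ∘ tl (phi_ j) ∘ tr (phi_ l)
     - tl (phi_ i) ∘ tr (phi_ j) ∘ tl (phi_ l)).

Definition Xi2_YI : {linear V ^⊗ 3 -> V ^⊗ 2} :=
  \sum_(t <- Gamma2) let: (i, j, l) := t in
    tl (psi_ i) ∘ tr (phi_ j) ∘ tl (phi_ l).
Definition Omega2_YI : {linear V ^⊗ 3 -> V ^⊗ 2} := phi1 ∘ tr psi1.

Definition Xi2_IY : {linear V ^⊗ 3 -> V ^⊗ 2} :=
  \sum_(t <- Gamma2) let: (i, j, l) := t in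
    tr (psi_ i) ∘ tl (phi_ j) ∘ tr (phi_ l).
Definition Omega2_IY : {linear V ^⊗ 3 -> V ^⊗ 2} := phi1 ∘ tl psi1.

Definition Lambda2 : {linear V ^⊗ 3 -> V ^⊗ 1} :=
  psi1 ∘ tr psi1 - psi1 ∘ tl psi1.

Definition obstruction2 : C3_YBH :=
  (Theta2, Xi2_YI - Omega2_YI, Xi2_IY - Omega2_IY, Lambda2).

End Obstruction.

End Complex.

(* Main.v *)
Require Import Defs.
From mathcomp Require Import all_boot ssrAC ssralg poly polydiv qpoly.

Set Implicit Arguments.
Unset Strict Implicit.
Unset Printing Implicit Defensive.

Import GRing.Theory.
Local Open Scope ring_scope.

(** The idea is a Bianchi identity. For arbitrary maps mu and R, satisfying no
    equation at all, let D(mu, R) be the tuple of the four differences whose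
    vanishing makes (V, mu, R) a braided algebra ([braided_defect]). Each
    component of the third differential, formed with mu and R and applied to
    D(mu, R), is the sum of the differences between consecutive words along a
    closed path: each step rewrites one side of a braided algebra equation into
    the other, or slides past each other two maps acting on disjoint tensor
    factors. So delta3(mu, R) (D(mu, R)) = 0 always ([delta3_braided_defect]).

    Apply this over A = k[h]/(h^3), to mu_h = mu + h psi1 and R_h = R + h phi1.
    Expanding in powers of h ([braided_defect_expand]),
      D(mu_h, R_h) = D(mu, R) + h delta2(phi1, psi1) + h^2 obstruction2 + h^3 E,
    where D(mu, R) = 0 because V is a braided algebra and delta2(phi1, psi1) = 0
    because the same expansion over k[h]/(h^2) vanishes
    ([infinitesimal_delta2]). As h^3 = 0, only h^2 obstruction2 remains, and the
    Bianchi identity reads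
      0 = delta3(mu_h, R_h) (h^2 obstruction2) = h^2 delta3(mu, R) (obstruction2),
    the last step because the factor h^2 kills the terms of mu_h and R_h that
    involve h ([delta3_cong]). Reading off the coefficient of h^2 gives the
    result.

    Two ingredients support this. Whiskering by an identity on either side is
    functorial and obeys the interchange law. Extension of scalars commutes with
    everything in sight, once the tensor powers of V (x) A over A are identified
    with the tensor powers of V extended to A ([bextend]). *)

(** * Composition of linear maps *)

Section LinComp.
Variables (k : comNzRingType) (U V W X : lmodType k).

Lemma compE (f : {linear V -> W}) (g : {linear U -> V}) x : (f ∘ g) x = f (g x).
Proof. by []. Qed.
Lemma compA (f : {linear W -> X}) (g : {linear V -> W}) (h : {linear U -> V}) :
  f ∘ (g ∘ h) = f ∘ g ∘ h.
Proof. exact: linP. Qed.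
Lemma compDl (f g : {linear V -> W}) (h : {linear U -> V}) :
  (f + g) ∘ h = f ∘ h + g ∘ h.
Proof. exact: linP. Qed.
Lemma compDr (f : {linear V -> W}) (g h : {linear U -> V}) :
  f ∘ (g + h) = f ∘ g + f ∘ h.
Proof. by apply: linP => x; rewrite !compE linDE linearD. Qed.
Lemma compNl (f : {linear V -> W}) (h : {linear U -> V}) : (- f) ∘ h = - (f ∘ h).
Proof. exact: linP. Qed.
Lemma compNr (f : {linear V -> W}) (h : {linear U -> V}) : f ∘ (- h) = - (f ∘ h).
Proof. by apply: linP => x; rewrite !compE linNE linearN. Qed.
Lemma compZl a (f : {linear V -> W}) (h : {linear U -> V}) :
  (a *: f) ∘ h = a *: (f ∘ h).
Proof. exact: linP. Qed.
Lemma compZr a (f : {linear V -> W}) (h : {linear U -> V}) :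
  f ∘ (a *: h) = a *: (f ∘ h).
Proof. by apply: linP => x; rewrite !compE linZE linearZZ. Qed.

End LinComp.

(** * Whiskering and the interchange law *)

Section Whiskering.
Variables (k : comNzRingType) (V : lmodType k).

(** [tens y b] seen in [V ^⊗ n.+2] rather than in the tensor product that this
    unfolds to, which is the form that rules about [tr] and [tl] can match. *)
Definition append n (y : V ^⊗ n.+1) (b : V) : V ^⊗ n.+2 := tens y b.
Definition prepend n (a : V) (y : V ^⊗ n.+1) : V ^⊗ n.+2 := tcons V n (tens a y).

Lemma append_ind n (P : V ^⊗ n.+2 -> Prop) :
  (forall y b, P (append y b)) -> (forall x y, P x -> P y -> P (x + y)) ->
  forall x, P x.
Proof. exact: (@tens_ind _ (V ^⊗ n.+1) V). Qed.

Lemma appendDl n (x y : V ^⊗ n.+1) b : append (x + y) b = append x b + append y b.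
Proof. exact: tensDl. Qed.
Lemma appendZl n c (x : V ^⊗ n.+1) b : append (c *: x) b = c *: append x b.
Proof. exact: tensZl. Qed.
Lemma prependDr n a (x y : V ^⊗ n.+1) : prepend a (x + y) = prepend a x + prepend a y.
Proof. by rewrite /prepend tensDr linearD. Qed.
Lemma prependZr n c a (x : V ^⊗ n.+1) : prepend a (c *: x) = c *: prepend a x.
Proof. by rewrite /prepend tensZr linearZZ. Qed.

(** Both sides are a ⊗ y ⊗ b, so this is the associativity of the tensor product. *)
Lemma prepend_append n a (y : V ^⊗ n.+1) b :
  prepend a (append y b) = append (prepend a y) b.
Proof.
transitivity (tmap (tcons V n) (lin_id V)
  (tassoc_inv V (V ^⊗ n.+1) V (tens a (tens y b)))); first by [].
by rewrite tassoc_invE tmapE.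
Qed.

Lemma tuncons_append n a (y : V ^⊗ n.+1) x b :
  tuncons V n x = tens a y -> tuncons V n.+1 (append x b) = tens a (append y b).
Proof.
move=> e; transitivity (tassoc V (V ^⊗ n.+1) V
  (tmap (tuncons V n) (lin_id V) (tens x b))); first by [].
by rewrite tmapE e tassocE.
Qed.

Lemma tuncons_prepend n a (y : V ^⊗ n.+1) : tuncons V n (prepend a y) = tens a y.
Proof.
elim: n => [//|n IHn] in y *; elim/append_ind: y => [y b|x y IHx IHy].
  by rewrite prepend_append; exact: tuncons_append.
by rewrite prependDr linearD IHx IHy tensDr.
Qed.

(** Surjectivity of [tcons]: tensors starting with a chosen factor of V span.
    Together with [append_ind] this lets a map be tested on either end. *)
Lemma prepend_ind n (P : V ^⊗ n.+2 -> Prop) :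
  (forall a y, P (prepend a y)) -> (forall x y, P x -> P y -> P (x + y)) ->
  forall x, P x.
Proof.
elim: n => [|n IHn] in P *; first exact: tens_ind.
move=> Pp PD; elim/append_ind => [x b|//].
apply: (IHn (fun x => P (append x b))) => [a y|y z Py Pz].
  by rewrite -prepend_append.
by rewrite appendDl; exact: PD.
Qed.

Lemma tlE m n (f : {linear V ^⊗ m.+1 -> V ^⊗ n.+1}) a y :
  tl f (prepend a y) = prepend a (f y).
Proof.
transitivity (tcons V n (tmap (lin_id V) f (tuncons V m (prepend a y)))); first by [].
by rewrite tuncons_prepend tmapE.
Qed.
Lemma trE m n (f : {linear V ^⊗ m.+1 -> V ^⊗ n.+1}) y b :
  tr f (append y b) = append (f y) b.
Proof. exact: tmapE. Qed.

Lemma lin_prependP n (W : lmodType k) (f g : {linear V ^⊗ n.+2 -> W}) :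
  (forall a y, f (prepend a y) = g (prepend a y)) -> f = g.
Proof.
move=> fg; apply: linP; elim/prepend_ind => // x y fgx fgy.
by rewrite !linearD fgx fgy.
Qed.
Lemma lin_appendP n (W : lmodType k) (f g : {linear V ^⊗ n.+2 -> W}) :
  (forall y b, f (append y b) = g (append y b)) -> f = g.
Proof.
move=> fg; apply: linP; elim/append_ind => // x y fgx fgy.
by rewrite !linearD fgx fgy.
Qed.

Section Functor.
Variables l m n : nat.
Implicit Types (f : {linear V ^⊗ m.+1 -> V ^⊗ n.+1}) (g : {linear V ^⊗ l.+1 -> V ^⊗ m.+1}).

Lemma tr_comp f g : tr (f ∘ g) = tr f ∘ tr g.
Proof. by apply: lin_appendP => x a; rewrite compE !trE. Qed.
Lemma tl_comp f g : tl (f ∘ g) = tl f ∘ tl g.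
Proof. by apply: lin_prependP => a x; rewrite compE !tlE. Qed.
Lemma trD f f' : tr (f + f') = tr f + tr f'.
Proof. by apply: lin_appendP => x a; rewrite linDE !trE appendDl. Qed.
Lemma tlD f f' : tl (f + f') = tl f + tl f'.
Proof. by apply: lin_prependP => a x; rewrite linDE !tlE prependDr. Qed.
Lemma trZ c f : tr (c *: f) = c *: tr f.
Proof. by apply: lin_appendP => x a; rewrite linZE !trE appendZl. Qed.
Lemma tlZ c f : tl (c *: f) = c *: tl f.
Proof. by apply: lin_prependP => a x; rewrite linZE !tlE prependZr. Qed.
Lemma trN f : tr (- f) = - tr f.
Proof. by rewrite -scaleN1r trZ scaleN1r. Qed.
Lemma tlN f : tl (- f) = - tl f.
Proof. by rewrite -scaleN1r tlZ scaleN1r. Qed.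
Lemma tl_tr f : tl (tr f) = tr (tl f).
Proof.
apply: lin_prependP => a; elim/append_ind => [y b|x y IHx IHy].
  by rewrite tlE trE !prepend_append trE tlE.
by rewrite prependDr !linearD IHx IHy.
Qed.

End Functor.

(** Concatenation with a tensor of degree 2. The interchange law is checked on
    these, since a map acting on the first factors acts on x alone and one
    acting on the last two acts on y alone. *)
Definition tjoin n (x : V ^⊗ n.+1) (y : V ^⊗ 2) : V ^⊗ n.+3 :=
  tassoc_inv (V ^⊗ n.+1) V V (tens x y).

Lemma tjoin_append n (x : V ^⊗ n.+1) c d :
  tjoin x (@append 0 c d) = append (append x c) d.
Proof. exact: tassoc_invE. Qed.
Lemma tjoinDl n (x x' : V ^⊗ n.+1) y : tjoin (x + x') y = tjoin x y + tjoin x' y.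
Proof. by rewrite /tjoin tensDl linearD. Qed.
Lemma tjoinDr n (x : V ^⊗ n.+1) y y' : tjoin x (y + y') = tjoin x y + tjoin x y'.
Proof. by rewrite /tjoin tensDr linearD. Qed.

Lemma tjoin1 (a : V ^⊗ 1) y : tjoin a y = prepend a y.
Proof.
elim/append_ind: y => [c d|y y' IHy IHy']; last by rewrite tjoinDr IHy IHy' prependDr.
by rewrite tjoin_append prepend_append.
Qed.
Lemma tjoin_prepend n a (x : V ^⊗ n.+1) y : tjoin (prepend a x) y = prepend a (tjoin x y).
Proof.
elim/append_ind: y => [c d|y y' IHy IHy'].
  by rewrite !tjoin_append !prepend_append.
by rewrite !tjoinDr prependDr IHy IHy'.
Qed.

Lemma lin_tjoinP n (W : lmodType k) (f g : {linear V ^⊗ n.+3 -> W}) :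
  (forall x y, f (tjoin x y) = g (tjoin x y)) -> f = g.
Proof.
move=> fg; apply: lin_appendP => x d; elim/append_ind: x => [x c|x x' IHx IHx'].
  by rewrite -tjoin_append.
by rewrite appendDl !linearD IHx IHx'.
Qed.

Lemma tr_tjoin m n (f : {linear V ^⊗ m.+1 -> V ^⊗ n.+1}) x y :
  tr (tr f) (tjoin x y) = tjoin (f x) y.
Proof.
elim/append_ind: y => [c d|y y' IHy IHy']; last by rewrite !tjoinDr linearD IHy IHy'.
by rewrite !tjoin_append !trE.
Qed.

Lemma tl_tjoin22 (g : {linear V ^⊗ 2 -> V ^⊗ 2}) (x : V ^⊗ 2) y :
  tl (tl g) (tjoin x y) = tjoin x (g y).
Proof.
elim/prepend_ind: x => [a b|x x' IHx IHx']; last by rewrite !tjoinDl linearD IHx IHx'.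
by rewrite !tjoin_prepend !tjoin1 !tlE.
Qed.
Lemma tl_tjoin21 (g : {linear V ^⊗ 2 -> V ^⊗ 1}) (x : V ^⊗ 2) y :
  tl (tl g) (tjoin x y) = append x (g y).
Proof.
elim/prepend_ind: x => [a b|x x' IHx IHx'].
  by rewrite tjoin_prepend tjoin1 !tlE -prepend_append.
by rewrite !tjoinDl appendDl linearD IHx IHx'.
Qed.

Implicit Types (f g : {linear V ^⊗ 2 -> V ^⊗ 2}) (m : {linear V ^⊗ 2 -> V ^⊗ 1}).

(** The four instances of the interchange law for maps out of [V ^⊗ 2]; the digits
    are the output degrees of the left and of the right map. *)
Lemma slide22 f g : tr (tr f) ∘ tl (tl g) = tl (tl g) ∘ tr (tr f).
Proof.
by apply: lin_tjoinP => x y; rewrite [LHS]compE [RHS]compE tr_tjoin !tl_tjoin22 tr_tjoin.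
Qed.
Lemma slide21 f m : tr f ∘ tl (tl m) = tl (tl m) ∘ tr (tr f).
Proof.
by apply: lin_tjoinP => x y; rewrite [LHS]compE [RHS]compE tr_tjoin !tl_tjoin21 trE.
Qed.
Lemma slide12 m g : tr (tr m) ∘ tl (tl g) = tl g ∘ tr (tr m).
Proof.
by apply: lin_tjoinP => x y; rewrite [LHS]compE [RHS]compE tl_tjoin22 !tr_tjoin !tjoin1 tlE.
Qed.
Lemma slide11 m m' : tr m ∘ tl (tl m') = tl m' ∘ tr (tr m).
Proof.
by apply: lin_tjoinP => x y; rewrite [LHS]compE [RHS]compE tr_tjoin tl_tjoin21 trE tjoin1 tlE.
Qed.

End Whiskering.

(** * The Bianchi identity *)

Definition braided_defect (k : comNzRingType) (V : lmodType k)
    (mu : {linear V ^⊗ 2 -> V ^⊗ 1}) (R : {linear V ^⊗ 2 -> V ^⊗ 2}) : C3_YBH V :=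
  (tr R ∘ tl R ∘ tr R - tl R ∘ tr R ∘ tl R,
   tl mu ∘ tr R ∘ tl R - R ∘ tr mu,
   tr mu ∘ tl R ∘ tr R - R ∘ tl mu,
   mu ∘ tr mu - mu ∘ tl mu).

(** Replaces every composite by a variable, so that what is left is an identity
    between elements of an abelian group. *)
Ltac generalize_words :=
  repeat match goal with
  | |- context [@lin_comp ?k ?U ?V ?W ?f ?g] =>
      generalize (@lin_comp k U V W f g); intro
  end.

(** Moves the last term of a vanishing sum leftwards until it meets its opposite. *)
Ltac cancel_last :=
  match goal with
  | |- (?x - ?x = 0)%R => exact: subrr
  | |- (- ?x + ?x = 0)%R => exact: addNr
  | |- (?E - ?x = 0)%R =>
      repeat first [rewrite (addrK x) | rewrite (addrAC _ _ (- x))]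
  | |- (?E + ?x = 0)%R =>
      repeat first [rewrite (subrK x) | rewrite (addrAC _ _ x)]
  end.

(** Words are left-nested, so a relation between two adjacent factors is also
    needed behind an arbitrary prefix e. *)
Lemma comp_whisk (k : comNzRingType) (U V V' W X : lmodType k)
  (f : {linear V -> W}) (g : {linear U -> V}) (f' : {linear V' -> W}) (g' : {linear U -> V'}) :
  f ∘ g = f' ∘ g' -> forall e : {linear W -> X}, e ∘ f ∘ g = e ∘ f' ∘ g'.
Proof. by move=> fg e; rewrite -!compA fg. Qed.

Section BianchiIdentity.
Variables (k : comNzRingType) (V : lmodType k).
Variables (mu : {linear V ^⊗ 2 -> V ^⊗ 1}) (R : {linear V ^⊗ 2 -> V ^⊗ 2}).

Lemma delta3_YBHE b a a' c :
  delta3_YBH mu R (b, a, a', c) =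
  (delta3_YB R b, delta31_YI mu R b a, delta31_IY mu R b a',
   delta32_YI mu R a a', delta33_YI mu R a c, delta33_IY mu R a' c, delta3_H mu c).
Proof. by []. Qed.

(** With no hypothesis on mu and R: after expansion each word occurs twice with
    opposite signs, up to sliding maps on disjoint factors past each other. *)
Lemma delta3_braided_defect : delta3_YBH mu R (braided_defect mu R) = 0.
Proof.
rewrite delta3_YBHE /delta3_YB /delta31_YI /delta31_IY /delta32_YI /delta33_YI.
rewrite /delta33_IY /delta3_H; cbv zeta.
move: (slide22 R R) (slide21 R mu) (slide12 mu R) (slide11 mu mu) (tl_tr R) (tl_tr mu).
(* Naming these maps hides that [tl] is itself a composite: otherwise the
   distributivity rules would also expand its definition. *)
move Er1: (tr R) => r1; move Er2: (tl R) => r2.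
move En1: (tr mu) => n1; move En2: (tl mu) => n2 => e1 e2 e3 e4 er en.
rewrite !(trD, tlD) !(trN, tlN) !(tr_comp, tl_comp) er en ?(Er1, Er2, En1, En2).
move: (tr r1) (tr r2) (tl r2) (tr n1) (tr n2) (tl n2) {er en} e1 e2 e3 e4.
move=> R1 R2 R3 m1 m2 m3 e1 e2 e3 e4.
have f1 := comp_whisk e1; have f2 := comp_whisk e2.
have f3 := comp_whisk e3; have f4 := comp_whisk e4.
(* Orienting the sliding relations consistently gives equal words one normal
   form. *)
congr (_, _, _, _, _, _, _).
all: rewrite !(compDl, compDr, compNl, compNr).
all: rewrite ?compA ?opprD ?opprK ?addrA ?(f1, f2, f3, f4, e1, e2, e3, e4).
all: generalize_words; repeat cancel_last.
Qed.
End BianchiIdentity.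

(** * Extension of scalars *)

Section ScalarExtension.
Variables (k : comNzRingType) (A : comAlgType k) (V : lmodType k).
Let W : lmodType A := bchange A V.

(** The canonical isomorphism between the n-th tensor power of V ⊗ A over A and
    V^⊗n ⊗ A, for n > 0, with its inverse. *)
Fixpoint tpow_merge n : {linear W ^⊗ n.+1 -> bchange A (V ^⊗ n.+1)} :=
  if n is m.+1 then bmerge A (V ^⊗ m.+1) V ∘ tmap (tpow_merge m) (lin_id W)
  else lin_id W.
Fixpoint tpow_split n : {linear bchange A (V ^⊗ n.+1) -> W ^⊗ n.+1} :=
  if n is m.+1 then tmap (tpow_split m) (lin_id W) ∘ bsplit A (V ^⊗ m.+1) V
  else lin_id W.

Lemma tpow_merge_append n (x : W ^⊗ n.+1) y :
  tpow_merge n.+1 (append x y) = bmerge A (V ^⊗ n.+1) V (tens (tpow_merge n x) y).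
Proof.
transitivity (bmerge A (V ^⊗ n.+1) V (tmap (tpow_merge n) (lin_id W) (tens x y))).
  by [].
by rewrite tmapE.
Qed.
Lemma tmapK (U U' Z : lmodType A) (f : {linear U -> U'}) (g : {linear U' -> U}) :
  cancel f g -> cancel (tmap f (lin_id Z)) (tmap g (lin_id Z)).
Proof.
move=> fK; elim/tens_ind => [u z|x y IHx IHy]; last by rewrite !linearD IHx IHy.
by rewrite !tmapE fK.
Qed.
Lemma tpow_mergeK n : cancel (tpow_merge n) (tpow_split n).
Proof.
elim: n => [//|n IHn] x.
transitivity (tmap (tpow_split n) (lin_id W) (bsplit A (V ^⊗ n.+1) V
  (bmerge A (V ^⊗ n.+1) V (tmap (tpow_merge n) (lin_id W) x)))).
  by [].
by rewrite bmergeK tmapK.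
Qed.
Lemma tpow_splitK n : cancel (tpow_split n) (tpow_merge n).
Proof.
elim: n => [//|n IHn] x.
transitivity (bmerge A (V ^⊗ n.+1) V (tmap (tpow_merge n) (lin_id W)
  (tmap (tpow_split n) (lin_id W) (bsplit A (V ^⊗ n.+1) V x)))).
  by [].
by rewrite tmapK // bsplitK.
Qed.

(** The A-linear extension of f, transported to tensor powers over A. It agrees
    with [bextend21] and [bextend22] in their degrees. *)
Definition bextend m n (f : {linear V ^⊗ m.+1 -> V ^⊗ n.+1}) :
    {linear W ^⊗ m.+1 -> W ^⊗ n.+1} :=
  tpow_split n ∘ bmap A f ∘ tpow_merge m.

Lemma tpow_merge_bextend m n (f : {linear V ^⊗ m.+1 -> V ^⊗ n.+1}) x :
  tpow_merge n (bextend f x) = bmap A f (tpow_merge m x).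
Proof. exact: tpow_splitK. Qed.

Lemma bmap_comp (X Y Z : lmodType k) (f : {linear Y -> Z}) (g : {linear X -> Y}) x :
  bmap A (f ∘ g) x = bmap A f (bmap A g x).
Proof.
elim/btens_ind: x => [v a|x y IHx IHy]; last by rewrite !linearD IHx IHy.
by rewrite !bmapE.
Qed.
Lemma bmapD (X Y : lmodType k) (f g : {linear X -> Y}) :
  bmap A (f + g) = bmap A f + bmap A g.
Proof.
apply: linP; elim/btens_ind => [v a|x y IHx IHy]; last by rewrite !linearD IHx IHy.
by rewrite linDE !bmapE linDE btensDl.
Qed.

Section Functor.
Variables l m n : nat.
Implicit Types (f : {linear V ^⊗ m.+1 -> V ^⊗ n.+1}) (g : {linear V ^⊗ l.+1 -> V ^⊗ m.+1}).

Lemma bextend_comp f g : bextend (f ∘ g) = bextend f ∘ bextend g.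
Proof.
apply: linP => x; apply: (can_inj (@tpow_mergeK n)).
by rewrite [RHS](congr1 (tpow_merge n) (compE _ _ _)) !tpow_merge_bextend bmap_comp.
Qed.
Lemma bextendD f f' : bextend (f + f') = bextend f + bextend f'.
Proof. by rewrite /bextend bmapD compDr compDl. Qed.
Lemma bextendN f : bextend (- f) = - bextend f.
Proof.
apply: (@addrI _ (bextend f)); rewrite -bextendD !subrr.
by apply: (@addrI _ (bextend 0)); rewrite -bextendD !addr0.
Qed.
Lemma bextend_tr f : bextend (tr f) = tr (bextend f).
Proof.
apply: lin_appendP => x y; apply: (can_inj (@tpow_mergeK n.+1)).
rewrite tpow_merge_bextend trE !tpow_merge_append tpow_merge_bextend.
move: (tpow_merge m x) => z; elim/btens_ind: z => [v a|z z' IHz IHz']; last first.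
  by rewrite !(tensDl, linearD) IHz IHz'.
elim/btens_ind: y => [u b|y y' IHy IHy']; last first.
  by rewrite !(tensDr, linearD) IHy IHy'.
by rewrite bmapE !bmergeE bmapE trE.
Qed.

(** [tpow_merge] peels factors off on the right. Peeling one off on the left gives
    the same map, by induction; this is what makes extension of scalars
    compatible with [tl]. *)
Lemma tpow_merge_prepend p x (y : W ^⊗ p.+1) :
  tpow_merge p.+1 (prepend x y) =
  bmap A (tcons V p) (bmerge A V (V ^⊗ p.+1) (tens x (tpow_merge p y))).
Proof.
elim: p => [|p IHp] in y *.
  transitivity (bmerge A V V (tens x y)).
    by rewrite -[prepend x y]/(append (x : W ^⊗ 1) y) tpow_merge_append.
  move: (bmerge _ _ _ _) => z; elim/btens_ind: z => [v a|z z' IHz IHz'].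
    by rewrite bmapE.
  by rewrite linearD -IHz -IHz'.
elim/append_ind: y => [y z|y y' IHy IHy']; last first.
  by rewrite prependDr !linearD IHy IHy'.
rewrite prepend_append !tpow_merge_append IHp; move: (tpow_merge p y) => {IHp} {}y.
elim/btens_ind: x => [u a|x x' IHx IHx']; last first.
  by rewrite !(tensDl, linearD) IHx IHx'.
elim/btens_ind: y => [w b|y y' IHy IHy']; last first.
  by rewrite !(tensDl, tensDr, linearD) IHy IHy'.
elim/btens_ind: z => [v c|z z' IHz IHz']; last first.
  by rewrite !(tensDr, linearD) IHz IHz'.
rewrite !bmergeE !bmapE bmergeE mulrA; congr (btens _ _).
exact/esym/prepend_append.
Qed.

Lemma bextend_tl f : bextend (tl f) = tl (bextend f).
Proof.
apply: lin_prependP => x y; apply: (can_inj (@tpow_mergeK n.+1)).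
rewrite tpow_merge_bextend tlE !tpow_merge_prepend tpow_merge_bextend.
move: (tpow_merge m y) => {}y; elim/btens_ind: x => [u a|x x' IHx IHx']; last first.
  by rewrite !(tensDl, linearD) IHx IHx'.
elim/btens_ind: y => [w b|y y' IHy IHy']; last first.
  by rewrite !(tensDr, linearD) IHy IHy'.
rewrite bmapE !bmergeE !bmapE; congr (btens _ _).
exact: tlE.
Qed.

(** A linear functional on A with value 1 at a retracts V ⊗ A onto V along
    v ↦ v ⊗ a, hence recovers f from the values of its extension multiplied by a. *)
Lemma bextend_inj (lambda : A -> k) a f :
  {morph lambda : b c / b + c} -> (forall c b, lambda (c *: b) = c * lambda b) ->
  lambda a = 1 -> a *: bextend f = 0 -> f = 0.
Proof.
move=> lD lZ la f0; apply: linP => v.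
pose ev (w : V ^⊗ n.+1) (b : A) := lambda b *: w.
have ev_bal : balanced ev.
  split=> [w w' b|w b b'|c w b]; rewrite /ev; first by rewrite scalerDr.
    by rewrite lD scalerDl.
  by rewrite lZ scalerA mulrC.
have : btens (f v) a = 0 :> bchange A (V ^⊗ n.+1).
  have := congr1 (fun g : {linear W ^⊗ m.+1 -> W ^⊗ n.+1} =>
    tpow_merge n (g (tpow_split m (btens v 1)))) f0.
  by rewrite linZE linearZZ tpow_merge_bextend tpow_splitK bmapE btensZ mulr1 linear0.
move/(congr1 (tlift_fun ev)); rewrite tlift_tens // /ev la scale1r => ->.
exact: (tlift_zero ev_bal).
Qed.
End Functor.

Lemma bextend21E (f : {linear V ^⊗ 2 -> V ^⊗ 1}) : bextend21 A f = bextend f.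
Proof.
apply: linP; elim/append_ind => [x y|x y IHx IHy]; last by rewrite !linearD IHx IHy.
transitivity (tpow_merge 0 (bextend f (append (x : W ^⊗ 1) y))); last by [].
by rewrite tpow_merge_bextend tpow_merge_append.
Qed.
Lemma bextend22E (f : {linear V ^⊗ 2 -> V ^⊗ 2}) : bextend22 A f = bextend f.
Proof.
apply: linP; elim/append_ind => [x y|x y IHx IHy]; last by rewrite !linearD IHx IHy.
apply: (can_inj (@tpow_mergeK 1)); rewrite tpow_merge_bextend tpow_merge_append.
transitivity (bmerge A V V (bsplit A V V (bmap A f (bmerge A V V (tens x y))))).
  transitivity (bmerge A V V
    (tmap (lin_id W) (lin_id W) (bextend22 A f (append (x : W ^⊗ 1) y)))).
    by [].
  congr (bmerge A V V _); rewrite -[RHS]/(bextend22 A f (append (x : W ^⊗ 1) y)).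
  move: (bextend22 _ _ _); elim/append_ind => [u v|u v IHu IHv].
    by rewrite tmapE.
  by rewrite linearD IHu IHv.
by rewrite bsplitK.
Qed.

End ScalarExtension.

(** * Truncated polynomials *)

Section TruncatedPolynomials.
Variables (k : comNzRingType) (n : nat).
Let A : comAlgType k := {poly %/ ('X^(n.+2) : {poly k})}.
Let h : A := qpolyX ('X^(n.+2) : {poly k}).

Definition qcoef (i : nat) (q : {poly %/ ('X^(n.+2) : {poly k})}) : k :=
  (q : {poly k})`_i.
Lemma qcoefD i : {morph qcoef i : p q / p + q}.
Proof. by move=> p q; exact: coefD. Qed.
Lemma qcoefZ i c p : qcoef i (c *: p) = c * qcoef i p.
Proof. exact: coefZ. Qed.

Lemma qpolyX_exp i : h ^+ i = in_qpoly 'X^(n.+2) 'X^i.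
Proof. by rewrite rmorphXn. Qed.
Lemma qpolyX_nilp : h ^+ n.+2 = 0.
Proof.
rewrite qpolyX_exp; apply/val_inj; rewrite /= mk_monic_Xn.
by apply: Pdiv.RingMonic.rmodpp; apply: monicXn.
Qed.
Lemma qcoefX : qcoef n.+1 (h ^+ n.+1) = 1.
Proof.
rewrite qpolyX_exp /qcoef in_qpoly_small ?coefXn ?eqxx //.
by rewrite mk_monic_Xn !size_polyXn.
Qed.
End TruncatedPolynomials.

(** * Expansion of the defect along a deformation *)

Lemma comp2_expand (k : comNzRingType) (h : k) (U V W : lmodType k)
    (f f1 : {linear V -> W}) (g g1 : {linear U -> V}) :
  (f + h *: f1) ∘ (g + h *: g1) =
  f ∘ g + h *: (f1 ∘ g + f ∘ g1) + h ^+ 2 *: (f1 ∘ g1).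
Proof.
rewrite compDl !compDr !compZl !compZr scalerA -expr2 scalerDr !addrA.
by rewrite [_ + _ + h *: (f1 ∘ g)]addrAC.
Qed.

Lemma comp3_expand (k : comNzRingType) (h : k) (U V W X : lmodType k)
    (f f1 : {linear W -> X}) (g g1 : {linear V -> W}) (e e1 : {linear U -> V}) :
  (f + h *: f1) ∘ (g + h *: g1) ∘ (e + h *: e1) =
  f ∘ g ∘ e + h *: (f1 ∘ g ∘ e + f ∘ g1 ∘ e + f ∘ g ∘ e1)
  + h ^+ 2 *: (f1 ∘ g1 ∘ e + f1 ∘ g ∘ e1 + f ∘ g1 ∘ e1)
  + h ^+ 3 *: (f1 ∘ g1 ∘ e1).
Proof.
rewrite comp2_expand !compDl !compDr !compZl !compZr !compDl !scalerA.
rewrite -!exprSr -?expr2 -!addrA !scalerDr !addrA.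
by rewrite [LHS](ACl (1*3*4*2*7*5*6*8)).
Qed.

Section Delta2.
Variables (k : comNzRingType) (V : lmodType k).
Implicit Types (mu psi : {linear V ^⊗ 2 -> V ^⊗ 1}) (R phi : {linear V ^⊗ 2 -> V ^⊗ 2}).

(** The second differential of psi and phi, with the negative terms of each
    component grouped as the variation of the right-hand side of the equation
    being linearized. *)
Definition delta2_YBH mu R psi phi : C3_YBH V :=
  ((tr phi ∘ tl R ∘ tr R + tr R ∘ tl phi ∘ tr R + tr R ∘ tl R ∘ tr phi)
   - (tl phi ∘ tr R ∘ tl R + tl R ∘ tr phi ∘ tl R + tl R ∘ tr R ∘ tl phi),
   (tl psi ∘ tr R ∘ tl R + tl mu ∘ tr phi ∘ tl R + tl mu ∘ tr R ∘ tl phi)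
   - (phi ∘ tr mu + R ∘ tr psi),
   (tr psi ∘ tl R ∘ tr R + tr mu ∘ tl phi ∘ tr R + tr mu ∘ tl R ∘ tr phi)
   - (phi ∘ tl mu + R ∘ tl psi),
   (psi ∘ tr mu + mu ∘ tr psi) - (psi ∘ tl mu + mu ∘ tl psi)).

(** The terms of the defect that are cubic in the deformation; there is none for
    associativity, which is quadratic in the multiplication. The YI and IY
    equations have a cubic side and a quadratic one. *)
Definition braided_defect3 psi phi : C3_YBH V :=
  (tr phi ∘ tl phi ∘ tr phi - tl phi ∘ tr phi ∘ tl phi,
   tl psi ∘ tr phi ∘ tl phi, tr psi ∘ tl phi ∘ tr phi, 0).

Lemma sum3_sub (M : zmodType) (x1 y1 x2 y2 x3 y3 : M) :
  x1 - y1 + (x2 - y2) + (x3 - y3) = (x1 + x2 + x3) - (y1 + y2 + y3).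
Proof. by rewrite !opprD !addrA [LHS](ACl (1*3*5*2*4*6)). Qed.

Lemma obstruction2E mu R psi phi : obstruction2 mu R psi phi =
  ((tr phi ∘ tl phi ∘ tr R + tr phi ∘ tl R ∘ tr phi + tr R ∘ tl phi ∘ tr phi)
   - (tl phi ∘ tr phi ∘ tl R + tl phi ∘ tr R ∘ tl phi + tl R ∘ tr phi ∘ tl phi),
   (tl psi ∘ tr phi ∘ tl R + tl psi ∘ tr R ∘ tl phi + tl mu ∘ tr phi ∘ tl phi)
   - phi ∘ tr psi,
   (tr psi ∘ tl phi ∘ tr R + tr psi ∘ tl R ∘ tr phi + tr mu ∘ tl phi ∘ tr phi)
   - phi ∘ tl psi,
   psi ∘ tr psi - psi ∘ tl psi).
Proof.
rewrite /obstruction2 /Theta2 /Xi2_YI /Xi2_IY /Omega2_YI /Omega2_IY /Lambda2.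
rewrite /Gamma2 !big_cons !big_nil !addr0; cbv beta iota zeta.
by rewrite !(addrA (_ ∘ _ ∘ _)) addrA (sum3_sub (tr phi ∘ tl phi ∘ tr R)).
Qed.

(** Three cases because the two sides of the braided algebra equations have
    degrees (3, 3), (3, 2) and (2, 2) in the pair (mu, R). *)
Lemma cubic_sub (M : lmodType k) (h : k) (x0 x1 x2 x3 y0 y1 y2 y3 : M) :
  (x0 + h *: x1 + h ^+ 2 *: x2 + h ^+ 3 *: x3)
  - (y0 + h *: y1 + h ^+ 2 *: y2 + h ^+ 3 *: y3) =
  (x0 - y0) + h *: (x1 - y1) + h ^+ 2 *: (x2 - y2) + h ^+ 3 *: (x3 - y3).
Proof. by rewrite !scalerBr !opprD !addrA [LHS](ACl (1*5*2*6*3*7*4*8)). Qed.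

Lemma cubic_sub_quadratic (M : lmodType k) (h : k) (x0 x1 x2 x3 y0 y1 y2 : M) :
  (x0 + h *: x1 + h ^+ 2 *: x2 + h ^+ 3 *: x3) - (y0 + h *: y1 + h ^+ 2 *: y2) =
  (x0 - y0) + h *: (x1 - y1) + h ^+ 2 *: (x2 - y2) + h ^+ 3 *: x3.
Proof. by have := cubic_sub h x0 x1 x2 x3 y0 y1 y2 0; rewrite scaler0 addr0 subr0. Qed.

Lemma quadratic_sub (M : lmodType k) (h : k) (x0 x1 x2 y0 y1 y2 : M) :
  (x0 + h *: x1 + h ^+ 2 *: x2) - (y0 + h *: y1 + h ^+ 2 *: y2) =
  (x0 - y0) + h *: (x1 - y1) + h ^+ 2 *: (x2 - y2) + h ^+ 3 *: 0.
Proof. by have := cubic_sub_quadratic h x0 x1 x2 0 y0 y1 y2; rewrite scaler0 !addr0. Qed.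

Lemma braided_defect_expand mu R psi phi h :
  braided_defect (mu + h *: psi) (R + h *: phi) =
  braided_defect mu R + h *: delta2_YBH mu R psi phi + h ^+ 2 *: obstruction2 mu R psi phi
  + h ^+ 3 *: braided_defect3 psi phi.
Proof.
rewrite obstruction2E /braided_defect !(trD, tlD) !(trZ, tlZ) !comp3_expand !comp2_expand.
exact: (f_equal4 (fun b a a' c => (b, a, a', c))
  (cubic_sub h _ _ _ _ _ _ _ _) (cubic_sub_quadratic h _ _ _ _ _ _ _)
  (cubic_sub_quadratic h _ _ _ _ _ _ _) (quadratic_sub h _ _ _ _ _ _)).
Qed.

(** * The third differential modulo the annihilator of a scalar *)

(** Maps with equal multiples by a form a congruence for all the operations that
    the third differential is built from. [cong] follows the syntax of the two
    sides down to the hypotheses. *)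
Lemma comp_cong (a : k) (X Y Z : lmodType k) (f f' : {linear Y -> Z}) (g g' : {linear X -> Y}) :
  a *: f = a *: f' -> a *: g = a *: g' -> a *: (f ∘ g) = a *: (f' ∘ g').
Proof. by move=> ff gg; rewrite -compZl ff compZl -compZr gg compZr. Qed.
Lemma addr_cong (a : k) (X : lmodType k) (f f' g g' : X) :
  a *: f = a *: f' -> a *: g = a *: g' -> a *: (f + g) = a *: (f' + g').
Proof. by rewrite !scalerDr => -> ->. Qed.
Lemma oppr_cong (a : k) (X : lmodType k) (f f' : X) :
  a *: f = a *: f' -> a *: (- f) = a *: (- f').
Proof. by rewrite !scalerN => ->. Qed.
Lemma tr_cong (a : k) m n (f f' : {linear V ^⊗ m.+1 -> V ^⊗ n.+1}) :
  a *: f = a *: f' -> a *: tr f = a *: tr f'.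
Proof. by rewrite -!trZ => ->. Qed.
Lemma tl_cong (a : k) m n (f f' : {linear V ^⊗ m.+1 -> V ^⊗ n.+1}) :
  a *: f = a *: f' -> a *: tl f = a *: tl f'.
Proof. by rewrite -!tlZ => ->. Qed.

Lemma pair_cong (a : k) (X Y : lmodType k) (x x' : X) (y y' : Y) :
  a *: x = a *: x' -> a *: y = a *: y' -> a *: (x, y) = a *: (x', y').
Proof. exact: (@f_equal2 _ _ _ pair). Qed.

Ltac cong :=
  match goal with
  | |- ?x = ?x => reflexivity
  | |- _ *: (_ + _) = _ *: (_ + _) => apply: addr_cong; cong
  | |- _ *: (_, _) = _ *: (_, _) => apply: pair_cong; cong
  | |- _ *: (- _) = _ *: (- _) => apply: oppr_cong; cong
  | |- _ *: tr _ = _ *: tr _ => apply: tr_cong; cong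
  | |- _ *: tl _ = _ *: tl _ => apply: tl_cong; cong
  | |- _ *: (_ ∘ _) = _ *: (_ ∘ _) => apply: comp_cong; cong
  | |- _ => assumption
  end.

(** For a = h^2 with h^3 = 0, this replaces mu + h psi by mu and R + h phi by R. *)
Lemma delta3_cong (a : k) mu mu' R R' c :
  a *: mu = a *: mu' -> a *: R = a *: R' ->
  a *: delta3_YBH mu R c = a *: delta3_YBH mu' R' c.
Proof.
case: c => [[[b al] al'] g] em eR; rewrite !delta3_YBHE.
rewrite /delta3_YB /delta31_YI /delta31_IY /delta32_YI /delta33_YI.
rewrite /delta33_IY /delta3_H; cbv zeta.
cong.
Qed.

(** Each word of the third differential contains the cochain exactly once; [pull]
    takes the scalar out of that factor. *)
Lemma pair_pull (a : k) (X Y : lmodType k) (x x' : X) (y y' : Y) :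
  x' = a *: x -> y' = a *: y -> (x', y') = a *: (x, y).
Proof. by move=> -> ->. Qed.
Lemma addr_pull (a : k) (X : lmodType k) (x x' y y' : X) :
  x' = a *: x -> y' = a *: y -> x' + y' = a *: (x + y).
Proof. by move=> -> ->; rewrite scalerDr. Qed.
Lemma oppr_pull (a : k) (X : lmodType k) (x x' : X) : x' = a *: x -> - x' = a *: - x.
Proof. by move=> ->; rewrite scalerN. Qed.
Lemma compl_pull (a : k) (X Y Z : lmodType k) (f f' : {linear Y -> Z}) (g : {linear X -> Y}) :
  f' = a *: f -> f' ∘ g = a *: (f ∘ g).
Proof. by move=> ->; exact: compZl. Qed.
Lemma compr_pull (a : k) (X Y Z : lmodType k) (f : {linear Y -> Z}) (g g' : {linear X -> Y}) :
  g' = a *: g -> f ∘ g' = a *: (f ∘ g).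
Proof. by move=> ->; exact: compZr. Qed.

Ltac pull :=
  match goal with
  | |- (_, _) = _ *: (_, _) => apply: pair_pull; pull
  | |- _ + _ = _ *: (_ + _) => apply: addr_pull; pull
  | |- - _ = _ *: (- _) => apply: oppr_pull; pull
  | |- _ ∘ ?g = _ *: (_ ∘ ?g) => apply: compl_pull; pull
  | |- ?f ∘ _ = _ *: (?f ∘ _) => apply: compr_pull; pull
  | |- tr _ = _ *: tr _ => exact: trZ
  | |- tl _ = _ *: tl _ => exact: tlZ
  | |- _ => reflexivity
  end.

Lemma delta3_scale (a : k) mu R c : delta3_YBH mu R (a *: c) = a *: delta3_YBH mu R c.
Proof.
case: c => [[[b al] al'] g].
rewrite -[a *: (b, al, al', g)]/(a *: b, a *: al, a *: al', a *: g) !delta3_YBHE.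
rewrite /delta3_YB /delta31_YI /delta31_IY /delta32_YI /delta33_YI.
rewrite /delta33_IY /delta3_H; cbv zeta.
pull.
Qed.
End Delta2.

(** * Naturality under extension of scalars *)

Section Naturality.
Variables (k : comNzRingType) (A : comAlgType k) (V : lmodType k).
Implicit Types (mu psi : {linear V ^⊗ 2 -> V ^⊗ 1}) (R phi : {linear V ^⊗ 2 -> V ^⊗ 2}).

Definition bextend_C3 (c : C3_YBH V) : C3_YBH (bchange A V) :=
  let: (b, a, a', g) := c in (bextend A b, bextend A a, bextend A a', bextend A g).
Definition bextend_C4 (c : C4_YBH V) : C4_YBH (bchange A V) :=
  let: (c1, c2, c3, c4, c5, c6, c7) := c in
  (bextend A c1, bextend A c2, bextend A c3, bextend A c4, bextend A c5,
   bextend A c6, bextend A c7).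

(** Used from the inside out: the opposite orientation would also match [tl f],
    which is a composite by definition. *)
Definition bextend_fold :=
  (fun m n f => esym (@bextend_tr k A V m n f), fun m n f => esym (@bextend_tl k A V m n f),
   fun l m n f g => esym (@bextend_comp k A V l m n f g),
   fun m n f g => esym (@bextendD k A V m n f g), fun m n f => esym (@bextendN k A V m n f)).

Lemma bextend_C3_0 : bextend_C3 0 = 0.
Proof.
have e0 p q : bextend A (0 : {linear V ^⊗ p.+1 -> V ^⊗ q.+1}) = 0.
  by apply: (@addrI _ (bextend A 0)); rewrite -bextendD !addr0.
by congr (_, _, _, _); exact: e0.
Qed.
Lemma bextend_braided_defect mu R :
  braided_defect (bextend A mu) (bextend A R) = bextend_C3 (braided_defect mu R).
Proof. by rewrite /braided_defect !bextend_fold. Qed.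
Lemma bextend_delta2 mu R psi phi :
  delta2_YBH (bextend A mu) (bextend A R) (bextend A psi) (bextend A phi) =
  bextend_C3 (delta2_YBH mu R psi phi).
Proof. by rewrite /delta2_YBH !bextend_fold. Qed.
Lemma bextend_obstruction2 mu R psi phi :
  obstruction2 (bextend A mu) (bextend A R) (bextend A psi) (bextend A phi) =
  bextend_C3 (obstruction2 mu R psi phi).
Proof. by rewrite !obstruction2E !bextend_fold. Qed.
Lemma bextend_delta3 mu R c :
  delta3_YBH (bextend A mu) (bextend A R) (bextend_C3 c) = bextend_C4 (delta3_YBH mu R c).
Proof.
case: c => [[[b al] al'] g].
rewrite /bextend_C3 !delta3_YBHE /bextend_C4.
rewrite /delta3_YB /delta31_YI /delta31_IY /delta32_YI /delta33_YI.
rewrite /delta33_IY /delta3_H; cbv zeta.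
by rewrite !bextend_fold.
Qed.

End Naturality.

(** * The top coefficient and the conclusion *)

Lemma braided_defect_eq0 (k : comNzRingType) (V : lmodType k)
    (mu : {linear V ^⊗ 2 -> V ^⊗ 1}) (R : {linear V ^⊗ 2 -> V ^⊗ 2}) :
  braided_algebra mu R -> braided_defect mu R = 0.
Proof.
by case=> hH [_ hYB] hYI hIY; rewrite /braided_defect hH hYB hYI hIY !subrr.
Qed.

Section TopCoefficient.
Variables (k : comNzRingType) (V : lmodType k) (n : nat).
Let A : comAlgType k := {poly %/ ('X^(n.+2) : {poly k})}.
Let h : A := qpolyX ('X^(n.+2) : {poly k}).

Lemma top_coef_inj p q (f : {linear V ^⊗ p.+1 -> V ^⊗ q.+1}) :
  h ^+ n.+1 *: bextend A f = 0 -> f = 0.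
Proof.
exact: (bextend_inj (@qcoefD k n n.+1) (@qcoefZ k n n.+1) (@qcoefX k n)).
Qed.

Lemma top_coef_C3 (c : C3_YBH V) : h ^+ n.+1 *: bextend_C3 A c = 0 -> c = 0.
Proof.
case: c => [[[b a] a'] g] e; congr (_, _, _, _); apply: top_coef_inj.
- exact: (congr1 (fun c => c.1.1.1) e).
- exact: (congr1 (fun c => c.1.1.2) e).
- exact: (congr1 (fun c => c.1.2) e).
- exact: (congr1 snd e).
Qed.
Lemma top_coef_C4 (c : C4_YBH V) : h ^+ n.+1 *: bextend_C4 A c = 0 -> c = 0.
Proof.
case: c => [[[[[[c1 c2] c3] c4] c5] c6] c7] e.
congr (_, _, _, _, _, _, _); apply: top_coef_inj.
- exact: (congr1 (fun c => c.1.1.1.1.1.1) e).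
- exact: (congr1 (fun c => c.1.1.1.1.1.2) e).
- exact: (congr1 (fun c => c.1.1.1.1.2) e).
- exact: (congr1 (fun c => c.1.1.1.2) e).
- exact: (congr1 (fun c => c.1.1.2) e).
- exact: (congr1 (fun c => c.1.2) e).
- exact: (congr1 snd e).
Qed.
End TopCoefficient.

(** The coefficient of h in the expanded defect: an infinitesimal deformation is a
    cocycle for the second differential. *)
Lemma infinitesimal_delta2 (k : comNzRingType) (V : lmodType k)
    (mu psi1 : {linear V ^⊗ 2 -> V ^⊗ 1}) (R phi1 : {linear V ^⊗ 2 -> V ^⊗ 2}) :
  braided_defect mu R = 0 -> infinitesimal_deformation mu R psi1 phi1 ->
  delta2_YBH mu R psi1 phi1 = 0.
Proof.
move=> d0 /braided_defect_eq0; rewrite !bextend21E !bextend22E.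
have h2 : qpolyX ('X^2 : {poly k}) ^+ 2 = 0 := qpolyX_nilp k 0.
rewrite braided_defect_expand (exprS _ 2) h2 mulr0 !scale0r !addr0.
rewrite bextend_braided_defect bextend_delta2 d0 bextend_C3_0.
by rewrite add0r => e; apply: (@top_coef_C3 _ _ 0); rewrite expr1.
Qed.

Theorem lemma6p6 (k : comNzRingType) (V : lmodType k)
    (mu : {linear V ^⊗ 2 -> V ^⊗ 1}) (R : {linear V ^⊗ 2 -> V ^⊗ 2})
    (psi1 : {linear V ^⊗ 2 -> V ^⊗ 1}) (phi1 : {linear V ^⊗ 2 -> V ^⊗ 2}) :
  braided_algebra mu R ->
  infinitesimal_deformation mu R psi1 phi1 ->
  delta3_YBH mu R (obstruction2 mu R psi1 phi1) = 0.
Proof.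
move=> /braided_defect_eq0 d0 /(infinitesimal_delta2 d0) d1.
pose A : comAlgType k := {poly %/ ('X^3 : {poly k})}.
pose h : A := qpolyX ('X^3 : {poly k}).
have h3 : h ^+ 3 = 0 := qpolyX_nilp k 1.
have := delta3_braided_defect (bextend A mu + h *: bextend A psi1)
  (bextend A R + h *: bextend A phi1).
rewrite braided_defect_expand h3 scale0r addr0 bextend_braided_defect.
rewrite bextend_delta2 bextend_obstruction2 d0 d1 bextend_C3_0.
rewrite scaler0 !add0r delta3_scale => e.
apply: (@top_coef_C4 _ _ 1); rewrite -bextend_delta3 -[RHS]e.
apply: delta3_cong.
  by rewrite scalerDr scalerA -exprSr h3 scale0r addr0.
by rewrite scalerDr scalerA -exprSr h3 scale0r addr0.
Qed.
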